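(* Let $n\ge 0$ and $m\ge 1$ be integers, let $a,b\in\mathbb C$, and write $U_{n,m}:=U_{n,m}^{(0)}(z,w;a,b)$ and $U_{n,m}^{(1)}:=U_{n,m}^{(1)}(z,w;a,b)$, where $z=\frac12\left(e^x+e^{-x}-2\right)^{1/2}$ and $w=\frac12\left(e^x+e^{-x}+2\right)^{1/2}$ are regarded as functions of the variable $x$. Then $$U_{n,m-1}U_{n,m+1}=\left(-\bar a_{n+2m+2}z^2+\bar b_{n+2m+2}w^2\right)U_{n,m}^2+8z^2w^2\,D_x^2\,U_{n,m}\circ U_{n,m}-\frac{4}{(n+2m+1)^2}\,ab(a-b)\,z^2w^2\left(U_{n,m}^{(1)}\right)^2 .$$
   Context: For nonnegative integers $n,m$ put $[n;m]=\{1,2,\ldots,n,n+2,n+4,\ldots,n+2m\}$, and $[k]=\{1,\ldots,k\}$ ($[0]=\emptyset$). For a finite set $I$ of positive integers, $|I|$ denotes the SUM of its elements. For $I\subset[n;m]$ put $$\mathbf d_{n,m}(I)=\prod_{i\in I,\ j\in[n;m]\setminus I}\left|\frac{i+j}{i-j}\right|,\qquad \mathbf c(I)=\sum_{i\in I,\ i>n}\frac{i-n}{2}.$$ For parameters $a,b$ put $\bar a_k=a+(k-1)^2$, $\bar b_k=b+(k-1)^2$, $a_{2k}=\bar a_2\bar a_4\cdots\bar a_{2k}$, $a_{2k+1}=\bar a_1\bar a_3\cdots\bar a_{2k+1}$, and similarly $b_{2k}=\bar b_2\bar b_4\cdots\bar b_{2k}$, $b_{2k+1}=\bar b_1\bar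 b_3\cdots\bar b_{2k+1}$; for a set $I$ put $a_I=\prod_{i\in I}a_i$, $b_I=\prod_{i\in I}b_i$. For $0\le k\le n$ the generalized Umemura polynomial is $$U^{(k)}_{n,m}(z,w;a,b)=\sum_{[k]\subset I\subset[n;m]}\ \prod_{i\in I\setminus[k],\ j\in[k]}\left(\frac{i+j}{i-j}\right)\mathbf d_{n,m}(I)\,(-1)^{\mathbf c(I)}\,a_{I\setminus[k]}\,b_{[n;m]\setminus I}\,z^{|I\setminus[k]|}\,w^{|[n;m]\setminus I|}.$$ By convention $U^{(1)}_{0,m}=0$. For functions $f,g$ of $x$, with $'=d/dx$, the second Hirota derivative is $D_x^2 f\circ g=f''g-2f'g'+fg''$. The variable $x$ may be taken real positive, with positive square roots; then $w^2-z^2=1$.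
   Formalization: In the definition of U^{(k)} the factor (i+j)/(i-j) is replaced by (i+j)/(j-i); with the printed sign the identity fails for n=m=1, where the left side minus the right side is -4a^2b^2(a-b)(a+4)(b+4)z^5w^5. *)

(* Defs.v *)
From HB Require Import structures.
From mathcomp Require Import all_boot all_order all_algebra.
From mathcomp Require Import all_classical all_reals all_analysis.
From mathcomp Require Import complex.

Set Implicit Arguments.
Unset Strict Implicit.
Unset Printing Implicit Defensive.

Import Order.TTheory GRing.Theory Num.Theory.
Import numFieldNormedType.Exports.

Local Open Scope ring_scope.

Section Umemura.
Variable C : numFieldType.

Definition bar (a : C) (k : nat) : C := a + (k%:R - 1) ^+ 2.

(** [stepprod a i] is a_i: the product of [bar a j] over those j in 1..i that
    have the parity of i. *)
Definition stepprod (a : C) (i : nat) : C :=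
  \prod_(1 <= j < i.+1 | odd j == odd i) bar a j.

(** [n;m] = {1, ..., n, n+2, ..., n+2m} and [k] = {1, ..., k}, as sets of
    ordinals below n+2m+1; the ordinal 0 is never a member. *)
Definition brack (n m : nat) : {set 'I_(n + 2 * m).+1} :=
  [set i : 'I_(n + 2 * m).+1 | (0 < i <= n)%N || ((n < i)%N && ~~ odd (i - n))].

Definition initseg (n m k : nat) : {set 'I_(n + 2 * m).+1} :=
  [set i : 'I_(n + 2 * m).+1 | (0 < i <= k)%N].

Definition wt (N : nat) (I : {set 'I_N}) : nat := (\sum_(i in I) i)%N.

Definition dcoef (n m : nat) (I : {set 'I_(n + 2 * m).+1}) : C :=
  \prod_(i in I) \prod_(j in brack n m :\: I)
    `|(i%:R + j%:R) / (i%:R - j%:R)|.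

Definition cexp (n m : nat) (I : {set 'I_(n + 2 * m).+1}) : nat :=
  (\sum_(i in I | n < i) (i - n)./2)%N.

Definition prodset (a : C) (N : nat) (I : {set 'I_N}) : C :=
  \prod_(i in I) stepprod a i.

(** The generalized Umemura polynomial U^(k)_{n,m}(z,w;a,b), set to 0 outside
    the range k <= n; this includes the convention U^(1)_{0,m} = 0.

    Sign convention: the cross factor between i in I \ [k] and j in [k] is
    (i + j) / (j - i), i.e. the smaller index comes first in the difference.
    With (i + j) / (i - j) instead, each summand would change by the factor
    (-1)^(k * #|I \ [k]|); this is immaterial for k = 0, but for k = 1 the
    bilinear relation between U^(0) and U^(1) fails with that sign:
    for n = m = 1 its left side minus its right side would be
    - 4 a^2 b^2 (a - b) (a + 4) (b + 4) z^5 w^5. *)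
Definition umemura (n m k : nat) (a b z w : C) : C :=
  if (k <= n)%N then
    \sum_(I : {set 'I_(n + 2 * m).+1}
            | (initseg n m k \subset I) && (I \subset brack n m))
      (\prod_(i in I :\: initseg n m k) \prod_(j in initseg n m k)
         ((i%:R + j%:R) / (j%:R - i%:R)))
      * dcoef I * (-1) ^+ cexp I
      * prodset a (I :\: initseg n m k) * prodset b (brack n m :\: I)
      * z ^+ wt (I :\: initseg n m k) * w ^+ wt (brack n m :\: I)
  else 0.

End Umemura.

Section Functions.
Variable R : realType.

Definition zfun (x : R) : R := 2^-1 * Num.sqrt (expR x + expR (- x) - 2).
Definition wfun (x : R) : R := 2^-1 * Num.sqrt (expR x + expR (- x) + 2).

Definition umemura_fun (n m k : nat) (a b : R[i]) (x : R) : R[i] :=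
  umemura n m k a b (zfun x)%:C%C (wfun x)%:C%C.

(** Derivative of a complex-valued function of a real variable. *)
Definition cderive (f : R -> R[i]) (x : R) : R[i] :=
  Complex (derive1 (fun t => complex.Re (f t) : R) x)
          (derive1 (fun t => complex.Im (f t) : R) x).

Definition hirota2 (f g : R -> R[i]) (x : R) : R[i] :=
  cderive (cderive f) x * g x - 2 * (cderive f x * cderive g x)
  + f x * cderive (cderive g) x.

End Functions.

(* Main.v *)
Require Import Defs.
From HB Require Import structures.
From mathcomp Require Import all_boot all_order all_fingroup all_algebra.
From mathcomp Require Import all_classical all_reals all_analysis.
From mathcomp Require Import complex fintype finset.
From mathcomp Require Import ring lra zify.

Set Implicit Arguments.
Unset Strict Implicit.
Unset Printing Implicit Defensive.

Import Order.TTheory GRing.Theory Num.Theory.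
Import numFieldNormedType.Exports.

Local Open Scope ring_scope.

(** Let t_0 < t_1 < t_2 < ... be the numbers 1, ..., n, n+2, n+4, ..., of which
    [n;m] consists of the first N = n + m, and for t >= 0 let L_t be the
    functional p |-> b_t w^t p(t) - a_t (-z)^t p(-t) on polynomials.  Expanding
    det (L_(t_j)(X^i)), i, j < N, along the choice of one of the points t_j, -t_j
    in each column gives Vandermonde determinants, and both the factors d(I) and
    the signs (-1)^c(I) are the quotients of these by the Vandermonde determinant
    of the t_j.  So U_{n,m} is det (L_(t_j)(X^i)) divided by that Vandermonde
    determinant ([umemura0_det]), and U^(1) is the same with t_0 = 1 left out, up
    to a product of rational numbers ([umemura1_det]).

    Since t_j does not depend on m, the polynomials for m - 1, m and m + 1 are
    three successive leading minors of one infinite array, and the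
    Desnanot-Jacobi identity ([ndet_jacobi]) writes the product of the outer two
    as D P1 - D1 P.  Here D is the N x N minor, the suffix 1 means that the last
    row X^(N-1) is replaced by X^N, and P means that the last column t_(N-1) is
    replaced by t_N.

    The recursion a_(t+2) = a_t (a + (t+1)^2) makes it possible to trade the
    column t_N for rows.  There is a difference operator M, raising degrees by
    one, such that L_t o M is a combination of L_(t+2), L_t and L_(t-2)
    ([contig_columns]).  The trace of adj A * B, where A is the matrix of D or of
    D1 and B has the entries L_(t_j)(M X^i), can be computed by replacing one
    column at a time or one row at a time ([ddet_col], [ddet_row]).  By columns it
    yields P or P1, because among the columns of B only those of t_(N-1) and of
    t_0 = 1 leave the span of the columns of A.  By rows it yields determinants
    with the last rows raised.  Eliminating the traces turns D P1 - D1 P into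
    D (D11 + D2) - D1^2 plus multiples of D D1 and D^2 ([bilinear_raw]), where
    D11 and D2 have the last rows X^(N-1), X^N and X^(N-2), X^(N+1).  What is left
    over by the column of t_0 = 1 is again of the shape of the Desnanot-Jacobi
    identity and becomes a multiple of the square of the minor without that
    column ([boundary_term]): this is the term with U^(1).

    On the analytic side z = sinh(x/2) and w = cosh(x/2).  Every summand of U is
    a constant times z^k w^l with k + l equal to the sum sigma of all t_j, and
    2 z w d/dx multiplies it by k w^2 + l z^2.  Hence 8 z^2 w^2 D_x^2 U o U is a
    quadratic expression in the moments of e = l - k, that is, in the sums of the
    summands multiplied by 1, e and e^2 ([hirota_sum]).  As e is the sum of the
    points chosen for a summand, and as raising the last row of a Vandermonde
    determinant multiplies it by the sum of its points, these moments are D, D1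
    and D11 + D2 up to the common denominator ([slater_rdet0], [slater_rdet1],
    [slater_rdet2]).  Comparing constants ([slot_weight_identity],
    [prod_slot_gap]) finishes the proof. *)

(** * Determinants of arrays and their differential *)

(** Arrays are indexed by all natural numbers, so that minors of different sizes
    are minors of one array and an equation between sizes can be rewritten. *)
Definition natmx (R : Type) (k : nat) (G : nat -> nat -> R) : 'M[R]_k :=
  \matrix_(i < k, j < k) G i j.

Definition ndet (R : comNzRingType) (k : nat) (G : nat -> nat -> R) : R :=
  \det (natmx k G).

(** The differential of the determinant at G in the direction H, by Jacobi's
    formula. *)
Definition ddet (R : comNzRingType) (k : nat) (G H : nat -> nat -> R) : R :=
  \tr (\adj (natmx k G) *m natmx k H).

Definition setrow (R : Type) (G : nat -> nat -> R) (i0 : nat) (u : nat -> R) :=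
  fun i j => if i == i0 then u j else G i j.
Definition setcol (R : Type) (G : nat -> nat -> R) (j0 : nat) (v : nat -> R) :=
  fun i j => if j == j0 then v i else G i j.

Section Arrays.
Variable R : comNzRingType.
Implicit Types (G H : nat -> nat -> R) (k : nat).

Lemma eq_ndet k G H :
  (forall i j, (i < k)%N -> (j < k)%N -> G i j = H i j) -> ndet k G = ndet k H.
Proof. by move=> GH; congr (\det _); apply/matrixP=> i j; rewrite !mxE GH. Qed.

Lemma eq_ddet k G G' H H' :
  (forall i j, (i < k)%N -> (j < k)%N -> G i j = G' i j) ->
  (forall i j, (i < k)%N -> (j < k)%N -> H i j = H' i j) ->
  ddet k G H = ddet k G' H'.
Proof.
move=> GG HH; rewrite /ddet; congr (\tr (\adj _ *m _)).
  by apply/matrixP=> i j; rewrite !mxE GG.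
by apply/matrixP=> i j; rewrite !mxE HH.
Qed.

Lemma ndet_tr k G : ndet k (fun i j => G j i) = ndet k G.
Proof.
by rewrite -[RHS]det_tr; congr (\det _); apply/matrixP=> i j; rewrite !mxE.
Qed.

Lemma ndet_setrow k G (i0 : 'I_k) u :
  ndet k (setrow G i0 u) = \sum_(j < k) u j * cofactor (natmx k G) i0 j.
Proof.
rewrite /ndet (expand_det_row _ i0); apply: eq_bigr => j _.
rewrite !mxE /setrow eqxx; congr (_ * _); rewrite /cofactor.
congr (_ * \det _); apply/matrixP=> i l; rewrite !mxE.
by rewrite (inj_eq val_inj) -[_ == i0]negbK eq_sym neq_lift.
Qed.

Lemma ndet_setcol k G (j0 : 'I_k) v :
  ndet k (setcol G j0 v) = \sum_(i < k) v i * cofactor (natmx k G) i j0.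
Proof.
rewrite -ndet_tr -[LHS]/(ndet k (setrow (fun i j => G j i) j0 v)) ndet_setrow.
apply: eq_bigr => i _; congr (_ * _); rewrite -[RHS]cofactor_tr.
by congr cofactor; apply/matrixP=> r c; rewrite !mxE.
Qed.

(** Cofactor expansion.  Together with [ddet_col] this converts relations between
    columns into relations between rows. *)
Lemma ddet_row k G H :
  ddet k G H = \sum_(i < k) ndet k (setrow G i (H i)).
Proof.
rewrite /ddet /mxtrace; under [RHS]eq_bigr do rewrite ndet_setrow.
rewrite exchange_big; apply: eq_bigr => j _; rewrite !mxE.
by apply: eq_bigr => i _; rewrite !mxE mulrC.
Qed.

Lemma ddet_col k G H :
  ddet k G H = \sum_(j < k) ndet k (setcol G j (fun i => H i j)).
Proof.
rewrite /ddet /mxtrace; under [RHS]eq_bigr do rewrite ndet_setcol.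
apply: eq_bigr => j _; rewrite !mxE.
by apply: eq_bigr => i _; rewrite !mxE mulrC.
Qed.

Lemma ddetD k G H H' :
  ddet k G (fun i j => H i j + H' i j) = ddet k G H + ddet k G H'.
Proof.
rewrite /ddet -linearD /= -mulmxDr; congr (\tr (_ *m _)).
by apply/matrixP=> i j; rewrite !mxE.
Qed.

Lemma ddet_mulr k G (T : nat -> nat -> R) :
  ddet k G (fun i j => \sum_(l < k) G i l * T l j)
  = ndet k G * \sum_(j < k) T j j.
Proof.
rewrite /ddet (_ : natmx k (fun i j => \sum_(l < k) G i l * T l j)
                  = natmx k G *m natmx k T); last first.
  by apply/matrixP=> i j; rewrite !mxE; apply: eq_bigr => l _; rewrite !mxE.
rewrite mulmxA mul_adj_mx mul_scalar_mx linearZ /=; congr (_ * _); rewrite /mxtrace.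
by apply: eq_bigr => j _; rewrite !mxE.
Qed.

Lemma ddet_mull k G (T : nat -> nat -> R) :
  ddet k G (fun i j => \sum_(l < k) T i l * G l j)
  = ndet k G * \sum_(j < k) T j j.
Proof.
rewrite /ddet (_ : natmx k (fun i j => \sum_(l < k) T i l * G l j)
                  = natmx k T *m natmx k G); last first.
  by apply/matrixP=> i j; rewrite !mxE; apply: eq_bigr => l _; rewrite !mxE.
rewrite mxtrace_mulC -mulmxA mul_mx_adj mul_mx_scalar linearZ /=.
by congr (_ * _); rewrite /mxtrace; apply: eq_bigr => j _; rewrite !mxE.
Qed.

Lemma ddet_diag k G (c : nat -> R) :
  ddet k G (fun i j => c j * G i j) = ndet k G * \sum_(j < k) c j.
Proof.
have -> : ddet k G (fun i j => c j * G i j)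
  = ddet k G (fun i j => \sum_(l < k) G i l * ((l == j :> nat)%:R * c j)).
  apply: eq_ddet => // i j _ ltj; rewrite (bigD1 (Ordinal ltj)) //= eqxx mul1r.
  rewrite big1 ?addr0 1?mulrC // => l nel.
  suff /negPf->: (l : nat) != j by rewrite mul0r mulr0.
  by apply: contraNneq nel => eql; apply/eqP/val_inj.
rewrite (@ddet_mulr k G (fun l j : nat => (l == j)%:R * c j)); congr (_ * _).
by apply: eq_bigr => j _; rewrite eqxx mul1r.
Qed.

Lemma ndet_row_eq k G i1 i2 : (i1 < k)%N -> (i2 < k)%N -> i1 != i2 ->
  (forall j, (j < k)%N -> G i1 j = G i2 j) -> ndet k G = 0.
Proof.
move=> lt1 lt2 ne12 eqG.
apply: (@determinant_alternate _ _ _ (Ordinal lt1) (Ordinal lt2)) => //.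
by move=> j; rewrite !mxE /= eqG.
Qed.

Lemma ndet_setrowZ k G i0 c u : (i0 < k)%N ->
  ndet k (setrow G i0 (fun j => c * u j)) = c * ndet k (setrow G i0 u).
Proof.
move=> lt0; rewrite -[i0]/(val (Ordinal lt0)) !ndet_setrow mulr_sumr.
by apply: eq_bigr => j _; rewrite mulrA.
Qed.

Lemma ndet_setcolZ k G j0 c v : (j0 < k)%N ->
  ndet k (setcol G j0 (fun i => c * v i)) = c * ndet k (setcol G j0 v).
Proof.
move=> lt0; rewrite -[j0]/(val (Ordinal lt0)) !ndet_setcol mulr_sumr.
by apply: eq_bigr => j _; rewrite mulrA.
Qed.

Lemma ndet_setrow0 k G i0 u : (i0 < k)%N -> (forall j, u j = 0) ->
  ndet k (setrow G i0 u) = 0.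
Proof.
move=> lt0 u0; rewrite -[i0]/(val (Ordinal lt0)) ndet_setrow big1 // => j _.
by rewrite u0 mul0r.
Qed.

Lemma ndet_setcol0 k G j0 v : (j0 < k)%N -> (forall i, v i = 0) ->
  ndet k (setcol G j0 v) = 0.
Proof.
move=> lt0 v0; rewrite -[j0]/(val (Ordinal lt0)) ndet_setcol big1 // => j _.
by rewrite v0 mul0r.
Qed.

Lemma ndet_scale_col k G (c : nat -> R) :
  ndet k (fun i j => c j * G i j) = (\prod_(j < k) c j) * ndet k G.
Proof.
rewrite /ndet (_ : natmx _ _ = natmx k G *m diag_mx (\row_j c j)); last first.
  by apply/matrixP=> i j; rewrite mul_mx_diag !mxE mulrC.
rewrite det_mulmx det_diag mulrC; congr (_ * _).
by apply: eq_bigr => j _; rewrite mxE.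
Qed.

(** Subtracting c times each row from the next one leaves only the top entry of
    the last column.  For columns of the form (phi (X^i))_i this multiplies the
    argument of phi by c - X. *)
Lemma ndet_geometric_last k G c : (forall i, G i k = c ^+ i) ->
  ndet k.+1 G = ndet k (fun i j => c * G i j - G i.+1 j).
Proof.
move=> Gk.
pose P : 'M[R]_k.+1 :=
  \matrix_(i, j) ((i == j)%:R - c * ((j.+1 : nat) == i)%:R).
have trigP : is_trig_mx P.
  apply/is_trig_mxP => i j ltij; rewrite mxE.
  rewrite -(inj_eq val_inj) /= (ltn_eqF ltij) gtn_eqF ?mulr0 ?subrr //.
  exact: ltnW.
have detP : \det P = 1.
  rewrite det_trig // big1 // => i _.
  by rewrite mxE eqxx gtn_eqF // mulr0 subr0.
have PG i j : (P *m natmx k.+1 G) i j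
    = if (i : nat) is i'.+1 then G i'.+1 j - c * G i' j else G 0%N j.
  rewrite mxE (bigD1 i) //= !mxE eqxx gtn_eqF // mulr0 subr0 mul1r.
  case: i => [[|i] lti] /=.
    rewrite big1 ?addr0 // => l nel; rewrite !mxE /= mulr0 subr0.
    by rewrite eq_sym (negPf nel) mul0r.
  have lti' : (i < k.+1)%N by apply: ltn_trans lti.
  rewrite (bigD1 (Ordinal lti')) /=; last by rewrite -(inj_eq val_inj) /= ltn_eqF.
  rewrite !mxE /= eqxx -(inj_eq val_inj) /= gtn_eqF // big1 ?addr0.
    by rewrite mulr1 sub0r mulNr.
  move=> l /andP[nel nel']; rewrite !mxE eqSS eq_sym (negPf nel).
  suff /negPf->: val l != i by rewrite mulr0 subr0 mul0r.
  by apply: contraNneq nel' => eql; apply/eqP/val_inj.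
rewrite /ndet -[LHS]mul1r -detP -det_mulmx.
rewrite (expand_det_col _ ord_max) big_ord_recl big1 ?addr0; last first.
  by move=> i _; rewrite PG /= !Gk exprS subrr mul0r.
rewrite PG /= Gk expr0 mul1r /cofactor add0n.
transitivity (ndet k (fun i j => -1 * (G i.+1 j - c * G i j))).
  rewrite ndet_scale_col prodr_const card_ord; congr (_ * \det _).
  apply/matrixP=> i j; rewrite 2!mxE PG !mxE /=.
  by rewrite /bump leqNgt ltn_ord.
by apply: eq_ndet => i j _ _; rewrite mulN1r opprB.
Qed.

End Arrays.

(** * The Desnanot-Jacobi identity *)

Section Jacobi.

(** Multiplication on the right by the block matrix with rows (adj A, - adj A B)
    and (0, det A) clears the upper right block without inverting A. *)
Lemma schur_adj (R : idomainType) (k q : nat) (A : 'M[R]_k) (B : 'M[R]_(k, q))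
    (C : 'M[R]_(q, k)) (E : 'M[R]_q) : \det A != 0 ->
  \det (block_mx A B C E) * \det A ^+ q
  = \det A * \det (\det A *: E - C *m \adj A *m B).
Proof.
move=> nzA; have nzAk : \det A ^+ k != 0 by rewrite expf_neq0.
apply: (mulIf nzAk).
have detadj : \det A * \det (\adj A) = \det A ^+ k.
  by rewrite -det_mulmx mul_mx_adj det_scalar.
have := congr1 determinant
  (mulmx_block A B C E (\adj A) (- (\adj A *m B)) 0 (\det A)%:M).
rewrite !mulmx0 !addr0 mul_mx_adj !mulmxN mulmxA mul_mx_adj mul_scalar_mx.
rewrite !mul_mx_scalar addNr det_mulmx det_ublock det_lblock !det_scalar.
rewrite mulmxA addrC => eqd.
transitivity (\det A *
  (\det (block_mx A B C E) * (\det (\adj A) * \det A ^+ q))).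
  by rewrite -detadj; ring.
by rewrite eqd; ring.
Qed.

Lemma det_bordered (R : idomainType) (k : nat) (A : 'M[R]_k) (b : 'cV[R]_k)
    (c : 'rV[R]_k) (e : 'M[R]_1) : \det A != 0 ->
  \det (block_mx A b c e) = (\det A *: e - c *m \adj A *m b) 0 0.
Proof.
move=> nzA; apply: (mulIf nzA).
by rewrite -{2}[\det A]expr1 schur_adj // det_mx11 mulrC.
Qed.

Lemma det_mx22 (R : comNzRingType) (S : 'M[R]_2) :
  \det S = S 0 0 * S 1 1 - S 0 1 * S 1 0.
Proof.
rewrite (expand_det_row _ ord0) !big_ord_recl big_ord0 addr0 /cofactor.
rewrite !det_mx11 !mxE /= expr0 expr1 mul1r mulN1r mulrN.
by congr (S _ _ * S _ _ - S _ _ * S _ _); apply/val_inj.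
Qed.

(** By [schur_adj] the bordered minors are the entries of the Schur complement
    det A *: E - C adj A B, whose determinant is computed once more by
    [schur_adj]. *)
Lemma jacobi_block_generic (R : idomainType) (k : nat) (A : 'M[R]_k)
    (B : 'M[R]_(k, 2)) (C : 'M[R]_(2, k)) (E : 'M[R]_2) : \det A != 0 ->
  let bd (i j : 'I_2) := \det (block_mx A (col j B) (row i C) (E i j)%:M) in
  \det A * \det (block_mx A B C E) = bd 0 0 * bd 1 1 - bd 0 1 * bd 1 0.
Proof.
move=> nzA bd; set S := \det A *: E - C *m \adj A *m B.
have bdE i j : bd i j = S i j.
  rewrite /bd det_bordered // /S !mxE; congr (_ - _).
  by apply: eq_bigr => l _; rewrite -row_mul !mxE.
rewrite !bdE -det_mx22; apply: (mulIf nzA).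
by rewrite mulrC mulrA -expr2 mulrC schur_adj // mulrC.
Qed.

(** As det A may vanish, the identity is proved for A + X over the polynomials,
    where the determinant is monic, and then evaluated at X = 0. *)
Lemma jacobi_block (K : fieldType) (k : nat) (A : 'M[K]_k)
    (B : 'M[K]_(k, 2)) (C : 'M[K]_(2, k)) (E : 'M[K]_2) :
  let bd (i j : 'I_2) := \det (block_mx A (col j B) (row i C) (E i j)%:M) in
  \det A * \det (block_mx A B C E) = bd 0 0 * bd 1 1 - bd 0 1 * bd 1 0.
Proof.
move=> bd; pose A' := char_poly_mx (- A).
have nzA' : \det A' != 0 by rewrite monic_neq0 // char_poly_monic.
have [ev evE] : exists ev : {rmorphism {poly K} -> K}, forall p, ev p = p.[0].
  by exists (horner_eval 0).
have evA : map_mx ev A' = A.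
  apply/matrixP=> i j; rewrite !mxE evE !hornerE.
  by rewrite hornerMn hornerX mul0rn sub0r opprK.
have evC q r (X : 'M[K]_(q, r)) : map_mx ev (map_mx polyC X) = X.
  by apply/matrixP=> i j; rewrite !mxE evE hornerC.
have := congr1 ev (jacobi_block_generic (map_mx polyC B) (map_mx polyC C)
                     (map_mx polyC E) nzA').
rewrite /= rmorphB !rmorphM -!det_map_mx !map_block_mx evA !evC.
by rewrite -!map_col -!map_row !map_scalar_mx !evC !mxE !evE !hornerC.
Qed.

Definition skip (k i : nat) : nat := if i == k then k.+1 else i.

(** The map [skip k] omits k, so the minors of size k+1 on the right are those
    that omit one of the last two rows and one of the last two columns. *)
Lemma ndet_jacobi (K : fieldType) (k : nat) (G : nat -> nat -> K) :
  ndet k G * ndet k.+2 G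
  = ndet k.+1 G * ndet k.+1 (fun i j => G (skip k i) (skip k j))
    - ndet k.+1 (fun i j => G i (skip k j))
      * ndet k.+1 (fun i j => G (skip k i) j).
Proof.
pose B : 'M[K]_(k, 2) := \matrix_(i, j) G i (k + j)%N.
pose C : 'M[K]_(2, k) := \matrix_(i, j) G (k + i)%N j.
pose E : 'M[K]_2 := \matrix_(i, j) G (k + i)%N (k + j)%N.
have whole : ndet k.+2 G = \det (block_mx (natmx k G) B C E).
  rewrite -(addn2 k) /ndet; congr (\det _); apply/matrixP=> i j.
  rewrite -(splitK i) -(splitK j).
  case: (split i) => i'; case: (split j) => j' /=;
  by rewrite ?(block_mxEul, block_mxEur, block_mxEdl, block_mxEdr) !mxE.
have minor (i j : 'I_2) : \det (block_mx (natmx k G) (col j B) (row i C) (E i j)%:M)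
   = ndet k.+1 (fun r c => G (if r == k then (k + i)%N else r)
                             (if c == k then (k + j)%N else c)).
  rewrite -(addn1 k) /ndet; congr (\det _); apply/matrixP=> r c.
  rewrite -(splitK r) -(splitK c).
  case: (split r) => r'; case: (split c) => c' /=;
  rewrite ?(block_mxEul, block_mxEur, block_mxEdl, block_mxEdr) !mxE /=.
  - by rewrite !ltn_eqF.
  - by rewrite (ltn_eqF (ltn_ord r')) ord1 addn0 eqxx.
  - by rewrite (ltn_eqF (ltn_ord c')) ord1 addn0 eqxx.
  - by rewrite !ord1 addn0 !eqxx.
rewrite whole {1}/ndet jacobi_block !minor /skip.
have sub0 (r : nat) : (if r == k then (k + 0)%N else r) = r.
  by case: eqP => // ->; rewrite addn0.
congr (_ * _ - _ * _); apply: eq_ndet => r c _ _; by rewrite /= ?sub0 ?addn1.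
Qed.

End Jacobi.

(** * Determinants with raised last rows *)

Section RaisedRows.
Variables (R : comNzRingType) (k : nat) (G : nat -> nat -> R).

(** Determinants with k+1 rows of G, where those of [rdet0] are 0, ..., k and the
    last rows are raised according to the partitions (1), (1,1) and (2).  The sum
    in [rdet11] has a single term, with the row k-1 of [rdet1] replaced by k; it
    is empty when k = 0, where there is no second row to raise. *)
Definition rdet0 := ndet k.+1 G.
Definition rdet1 := ndet k.+1 (fun i => G (skip k i)).
Definition rdet11 :=
  \sum_(i < k.+1 | i.+1 == k) ndet k.+1 (setrow (fun i => G (skip k i)) i (G k)).
Definition rdet2 := ndet k.+1 (setrow G k (G k.+2)).

Lemma skip_lt i : (i < k)%N -> skip k i = i.
Proof. by move=> ltik; rewrite /skip ltn_eqF. Qed.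

Lemma skip_last : skip k k = k.+1.
Proof. by rewrite /skip eqxx. Qed.

(** The rows of H that lie in the span of those of G contribute the trace of T;
    as T reaches at most one step above the diagonal, only the last row can leave
    that span. *)
Lemma ddet_rdet0 (T : nat -> nat -> R) (H : nat -> nat -> R) :
  (forall i l, (i.+1 < l)%N -> T i l = 0) ->
  (forall i j, (i <= k)%N -> H i j = \sum_(l < k.+2) T i l * G l j) ->
  ddet k.+1 G H = rdet0 * (\sum_(i < k.+1) T i i) + T k k.+1 * rdet1.
Proof.
move=> T0 HE.
have -> : ddet k.+1 G H = ddet k.+1 G (fun i j =>
    \sum_(l < k.+1) T i l * G l j + T i k.+1 * G k.+1 j).
  by apply: eq_ddet => // i j ltik _; rewrite HE // big_ord_recr.
rewrite ddetD ddet_mull ddet_row; congr (_ + _).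
rewrite big_ord_recr /= big1 ?add0r => [|i _].
  rewrite (@ndet_setrowZ _ _ G k (T k k.+1) (G k.+1)) //.
  congr (_ * _); apply: eq_ndet => i j lti _.
  by rewrite /setrow /skip; case: eqP.
rewrite ndet_setrow0 // => [|j]; first by rewrite ltnS ltnW.
by rewrite T0 ?mul0r ?ltnS.
Qed.

(** As in [ddet_rdet0].  Here the row k is missing, so the row k-1 can leave the
    span by reaching it from below, and the row k+1 by falling back to it or by
    reaching k+2. *)
Lemma ddet_rdet1 (T : nat -> nat -> R) (H : nat -> nat -> R) :
  (forall i l, (i.+1 < l)%N -> T i l = 0) ->
  (forall i j, (i <= k.+1)%N -> H i j = \sum_(l < k.+3) T i l * G l j) ->
  ddet k.+1 (fun i => G (skip k i)) (fun i => H (skip k i))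
  = rdet1 * (\sum_(i < k) T i i + T k.+1 k.+1) + T k.-1 k * rdet11
    + T k.+1 k * rdet0 + T k.+1 k.+2 * rdet2.
Proof.
move=> T0 HE; set G1 := fun i => G (skip k i).
have skip_le i : (i <= k)%N -> (skip k i <= k.+1)%N.
  by rewrite /skip; case: eqP => // _ /leqW.
have -> : ddet k.+1 G1 (fun i => H (skip k i)) = ddet k.+1 G1 (fun i j =>
    \sum_(l < k.+1) T (skip k i) (skip k l) * G1 l j
    + (T (skip k i) k * G k j + T (skip k i) k.+2 * G k.+2 j)).
  apply: eq_ddet => // i j ltik _; rewrite HE ?skip_le //.
  rewrite !big_ord_recr /= /G1 skip_last addrA; congr (_ + _).
  rewrite -!addrA [T _ k * _ + _]addrC; congr (_ + _).
  by apply: eq_bigr => l _; rewrite (skip_lt (ltn_ord l)).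
rewrite !ddetD (@ddet_mull _ _ G1 (fun i l => T (skip k i) (skip k l))).
rewrite !ddet_row -!addrA; congr (_ + _).
  rewrite big_ord_recr /= skip_last; congr (_ * (_ + _)).
  by apply: eq_bigr => i _; rewrite skip_lt.
rewrite addrA; congr (_ + _); last first.
  rewrite big_ord_recr /= big1 ?add0r => [|i _].
    rewrite skip_last (@ndet_setrowZ _ _ G1 k (T k.+1 k.+2) (G k.+2)) //.
    congr (_ * _); apply: eq_ndet => i j lti _.
    by rewrite /setrow /G1 /skip; case: eqP.
  rewrite ndet_setrow0 // => [|j]; first by rewrite ltnS ltnW.
  by rewrite skip_lt // T0 ?mul0r // !ltnS ltnW.
rewrite big_ord_recr /= skip_last (@ndet_setrowZ _ _ G1 k (T k.+1 k) (G k)) //.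
congr (_ + _ * _); last first.
  by apply: eq_ndet => i j lti _; rewrite /setrow /G1 /skip; case: eqP => [->|].
rewrite /rdet11 [in RHS]big_mkcond [in RHS]big_ord_recr /= gtn_eqF // addr0 mulr_sumr.
apply: eq_bigr => i _; case: eqP => [ik|/eqP nik].
  rewrite (@ndet_setrowZ _ _ G1 i (T (skip k i) k) (G k)) 1?ltnS 1?ltnW //.
  by rewrite skip_lt // -[in k.-1]ik.
rewrite mulr0 ndet_setrow0 // => [|j]; first by rewrite ltnS ltnW.
by rewrite skip_lt // T0 ?mul0r // ltn_neqAle nik /=.
Qed.

Lemma ddet_shift_rdet0 : ddet k.+1 G (fun i => G i.+1) = rdet1.
Proof.
rewrite (@ddet_rdet0 (fun i l => (l == i.+1)%:R)).
- rewrite eqxx mul1r big1 ?mulr0 ?add0r // => i _.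
  by rewrite ltn_eqF.
- by move=> i l lti; rewrite gtn_eqF.
move=> i j lei; rewrite (bigD1 (Ordinal (lei : (i.+1 < k.+2)%N))) //= eqxx mul1r.
rewrite big1 ?addr0 // => l nel.
suff /negPf->: (l : nat) != i.+1 by rewrite mul0r.
by apply: contraNneq nel => eql; apply/eqP/val_inj.
Qed.

Lemma ddet_shift_rdet1 :
  ddet k.+1 (fun i => G (skip k i)) (fun i => G (skip k i).+1) = rdet11 + rdet2.
Proof.
rewrite (@ddet_rdet1 (fun i l => (l == i.+1)%:R) (fun i => G i.+1)).
- rewrite eqxx mul1r [k.+1 == _]ltn_eqF // [k == k.+2]ltn_eqF //.
  rewrite big1 => [|i _]; last by rewrite ltn_eqF.
  rewrite addr0 mulr0 mul0r addr0 add0r; congr (_ + _).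
  case: (posnP k) => [k0|kp]; last by rewrite prednK // eqxx mul1r.
  by rewrite /rdet11 big1 ?mulr0 // => i /eqP ik; have := etrans ik k0.
- by move=> i l lti; rewrite gtn_eqF.
move=> i j lei; rewrite (bigD1 (Ordinal (lei : (i.+1 < k.+3)%N))) //= eqxx mul1r.
rewrite big1 ?addr0 // => l nel.
suff /negPf->: (l : nat) != i.+1 by rewrite mul0r.
by apply: contraNneq nel => eql; apply/eqP/val_inj.
Qed.

Lemma ndet_swap_rows i1 i2 (H : nat -> nat -> R) :
  (i1 < k.+1)%N -> (i2 < k.+1)%N -> i1 != i2 ->
  ndet k.+1 (setrow (setrow H i1 (H i2)) i2 (H i1)) = - ndet k.+1 H.
Proof.
move=> lt1 lt2 ne12; pose o1 := Ordinal lt1; pose o2 := Ordinal lt2.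
have detP : \det (perm_mx (tperm o1 o2)) = -1 :> R.
  by rewrite det_perm odd_tperm -(inj_eq val_inj) ne12.
rewrite /ndet -mulN1r -detP -det_mulmx -row_permE; congr (\det _).
apply/matrixP=> i j; rewrite !mxE /setrow.
case: tpermP => [->|->|/eqP ne1 /eqP ne2] /=.
- by rewrite (negPf ne12) eqxx.
- by rewrite eqxx.
by rewrite -[val i == i2]/(i == o2) -[val i == i1]/(i == o1) (negPf ne1) (negPf ne2).
Qed.

(** Only the last two rows can be raised by two without producing a repeated
    row.  Raising k-1 to k+1 puts the rows k+1 and k in the wrong order, whence
    the sign. *)
Lemma ddet_shift2 : ddet k.+1 G (fun i => G i.+2) = rdet2 - rdet11.
Proof.
rewrite ddet_row big_ord_recr /= addrC; congr (_ + _).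
rewrite /rdet11 [in RHS]big_mkcond [in RHS]big_ord_recr /= gtn_eqF // addr0 -sumrN.
apply: eq_bigr => i _; case: eqP => [ik|/eqP nik]; last first.
  rewrite oppr0; apply: (@ndet_row_eq _ _ _ i i.+2) => //.
  - by rewrite ltnS ltnW.
  - by rewrite !ltnS ltn_neqAle nik /=.
  - by rewrite ltn_eqF.
  by move=> j _; rewrite /setrow eqxx gtn_eqF.
have ltik : (i < k.+1)%N by rewrite ltnS ltnW.
have neik : (i : nat) != k by rewrite ltn_eqF.
rewrite -(@ndet_swap_rows i k) //; apply: eq_ndet => r c _ _.
rewrite /setrow eqxx [k == i]eq_sym (negPf neik) skip_last ik.
case: (eqVneq r k) => [->|rk]; first by rewrite eq_sym (negPf neik).
by case: eqP => // _; rewrite /skip (negPf rk).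
Qed.

End RaisedRows.

(** * The two-point functionals and the contiguity operator *)

Section StepProd.
Variables (C : numFieldType) (a : C).

Lemma stepprod0 : stepprod a 0 = 1.
Proof. by rewrite /stepprod big_geq. Qed.

Lemma stepprod1 : stepprod a 1 = a.
Proof. by rewrite /stepprod big_mkcond big_nat1 /= /bar subrr expr0n addr0. Qed.

Lemma stepprodSS t : stepprod a t.+2 = stepprod a t * (a + (t%:R + 1) ^+ 2).
Proof.
rewrite /stepprod big_mkcond [in RHS]big_mkcond.
rewrite big_nat_recr //= big_nat_recr //= !negbK eqxx.
rewrite (_ : (~~ odd t == odd t) = false) ?mulr1; last by case: (odd t).
by rewrite /bar -natr1 -[t.+1%:R]natr1 addrK.
Qed.
End StepProd.

Section BinomialTail.
Variable R : comNzRingType.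

(** The factor X^3 makes the binomial expansion up to the fourth term meaningful
    for all i, including i < 3. *)
Lemma exp_XaddC_top (c : R) i : exists2 q : {poly R}, (size q <= i)%N &
  'X^3 * ('X + c%:P) ^+ i
  = 'X^i * ('X^3 + (c * i%:R)%:P * 'X^2 + (c ^+ 2 * 'C(i, 2)%:R)%:P * 'X
            + (c ^+ 3 * 'C(i, 3)%:R)%:P) + q.
Proof.
elim: i => [|i [q szq IH]].
  exists 0; first by rewrite size_poly0.
  by rewrite !bin0n /= !mulr0 !polyC0 !mul0r !addr0 !expr0 mulr1 mul1r.
exists ((c ^+ 4 * 'C(i, 3)%:R)%:P * 'X^i + ('X + c%:P) * q).
  apply: (leq_trans (size_polyD _ _)); rewrite geq_max; apply/andP; split.
    rewrite mul_polyC; apply: (leq_trans (size_scale_leq _ _)).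
    by rewrite size_polyXn.
  apply: (leq_trans (size_polyMleq _ _)); by rewrite size_XaddC.
rewrite [(_ + _) ^+ i.+1]exprSr mulrA IH !binS bin1 !natrD.
rewrite ['X^(i.+1)]exprS -[i.+1%:R]natr1.
by rewrite !(polyCD, polyCM, polyC_exp, mulrDr); ring.
Qed.

Lemma bin2_ring i : 2 * 'C(i, 2)%:R = i%:R * (i%:R - 1) :> R.
Proof.
elim: i => [|i IH]; first by rewrite mulr0 mul0r.
by rewrite binS bin1 natrD mulrDr IH -natr1; ring.
Qed.

Lemma bin3_ring i : 6 * 'C(i, 3)%:R = i%:R * (i%:R - 1) * (i%:R - 2) :> R.
Proof.
elim: i => [|i IH]; first by rewrite mulr0 !mul0r.
rewrite binS natrD mulrDr IH.
have -> : 6 * 'C(i, 2)%:R = 3 * (i%:R * (i%:R - 1)) :> R.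
  by rewrite -bin2_ring; ring.
by rewrite -natr1; ring.
Qed.
End BinomialTail.

Section Contiguity.
Variables (K : numFieldType) (n : nat) (a b z w : K).
Hypothesis wz : w ^+ 2 = z ^+ 2 + 1.

(** The column of the determinant that belongs to the index t: its second term is
    the contribution of the subsets I containing t. *)
Definition twist_eval (t : nat) (p : {poly K}) : K :=
  stepprod b t * w ^+ t * p.[t%:R] - stepprod a t * (- z) ^+ t * p.[- t%:R].

Lemma twist_eval_sum t k (p : {poly K}) : (size p <= k)%N ->
  twist_eval t p = \sum_(l < k) p`_l * twist_eval t 'X^l.
Proof.
move=> szp; rewrite /twist_eval !(horner_coef_wide _ szp) !mulr_sumr -sumrB.
by apply: eq_bigr => l _; rewrite !hornerXn; ring.
Qed.

Lemma twist_evalX t i : twist_eval t 'X^i =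
  stepprod b t * w ^+ t * t%:R ^+ i - stepprod a t * (- z) ^+ t * (- t%:R) ^+ i.
Proof. by rewrite /twist_eval !hornerXn. Qed.

Lemma twist_eval0X i : twist_eval 0 'X^i = 0.
Proof. by rewrite twist_evalX !stepprod0 oppr0 subrr. Qed.

Let nu : K := n%:R - 1.
Let s : K := z ^+ 2 + w ^+ 2.

(** X times the image of X^i under the operator
      (M p)(y) = f(y) w^2 (b + (y+1)^2) p(y+2) - s y^2 p(y)
                 + f(-y) z^2 (a + (y-1)^2) p(y-2),   f(y) = 1 - (n-1)/y,
    plus the constant that makes the sum vanish at y = 0, where f has a pole.
    For every f, the symmetry under y |-> -y makes [twist_eval t] of M p a
    combination of the values of [twist_eval] at t+2, t and t-2.  This f vanishes
    at t = n-1, for which t+2 is not an index; and the middle term cancels the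
    leading degree, so that M raises degrees by one only. *)
Definition contig_num i : {poly K} :=
  ('X - nu%:P) * (w ^+ 2)%:P * (b%:P + ('X + 1%:P) ^+ 2) * ('X + 2%:P) ^+ i
  - s%:P * 'X^3 * 'X^i
  + ('X + nu%:P) * (z ^+ 2)%:P * (a%:P + ('X - 1%:P) ^+ 2) * ('X - 2%:P) ^+ i
  + (nu * twist_eval 2 'X^i)%:P.

Definition contig i : {poly K} := drop_poly 1 (contig_num i).

Lemma contig_num_eval i y : (contig_num i).[y] =
  (y - nu) * w ^+ 2 * (b + (y + 1) ^+ 2) * (y + 2) ^+ i - s * y ^+ 3 * y ^+ i
  + (y + nu) * z ^+ 2 * (a + (y - 1) ^+ 2) * (y - 2) ^+ i + nu * twist_eval 2 'X^i.
Proof. by rewrite /contig_num !hornerE. Qed.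

Lemma contig_num0 i : (contig_num i)`_0 = 0.
Proof.
rewrite -horner_coef0 contig_num_eval twist_evalX !stepprodSS !stepprod0.
rewrite (add0r 2) (sub0r 2).
by move: (2 ^+ i) ((- 2) ^+ i) (0 ^+ i) => p q r; ring.
Qed.

Lemma contig_eval i y : y * (contig i).[y] = (contig_num i).[y].
Proof.
rewrite -[in RHS](poly_take_drop 1 (contig_num i)) hornerD hornerM hornerXn expr1 mulrC.
suff -> : take_poly 1 (contig_num i) = 0 by rewrite horner0 add0r.
by apply/polyP=> [[|l]]; rewrite coef_take_poly coef0 // contig_num0.
Qed.

(** The coefficients of X^(i+1), X^i and, for i > 0, X^(i-1) in [contig i]. *)
Definition up_coef (i : nat) : K := 2 * i%:R + 2 - nu.
Definition diag_coef (i : nat) : K :=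
  s * (2 * (i%:R * (i%:R - 1)) + 2 * i%:R * (2 - nu) + 1 - 2 * nu)
  + w ^+ 2 * b + z ^+ 2 * a.
Definition down_coef (i : nat) : K :=
  4 / 3 * (i%:R * (i%:R - 1) * (i%:R - 2)) + 2 * (i%:R * (i%:R - 1)) * (2 - nu)
  + 2 * i%:R * (1 - 2 * nu) - nu + (2 * i%:R - nu) * (w ^+ 2 * b - z ^+ 2 * a).

Lemma contig_num_top i : exists2 q : {poly K}, (size q <= i.+3)%N &
  'X^3 * contig_num i = (up_coef i)%:P * 'X^(i + 5) + (diag_coef i)%:P * 'X^(i + 4)
                 + (down_coef i)%:P * 'X^(i + 3) + q + (nu * twist_eval 2 'X^i)%:P * 'X^3.
Proof.
(* A1 and A2 are the two cubic factors of [contig_num], and Q collects their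
   products with the first four terms of (X + 2)^i and (X - 2)^i in degree < i+3 *)
have [q1 sz1 E1] := exp_XaddC_top (2 : K) i.
have [q2 sz2 E2] := exp_XaddC_top (- 2 : K) i.
pose k : K := i%:R; pose c2 : K := 'C(i, 2)%:R; pose c3 : K := 'C(i, 3)%:R.
have cfE : up_coef i = (w ^+ 2 - z ^+ 2) * (2 * k + 2 - nu).
  by rewrite wz /up_coef /k; ring.
have k2 : k * (k - 1) = 2 * c2 by rewrite bin2_ring.
have k3 : k * (k - 1) * (k - 2) = 6 * c3 by rewrite bin3_ring.
have dfE : diag_coef i = (w ^+ 2 + z ^+ 2) * (4 * c2 + 2 * k * (2 - nu) + 1 - 2 * nu)
                  + w ^+ 2 * b + z ^+ 2 * a.
  by rewrite /diag_coef -/k k2 /s; ring.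
have efE : down_coef i = (w ^+ 2 - z ^+ 2) * (8 * c3 + 4 * c2 * (2 - nu)
      + 2 * k * (1 - 2 * nu) - nu) + (2 * k - nu) * (w ^+ 2 * b - z ^+ 2 * a).
  by rewrite /down_coef -/k k3 k2 wz; field.
pose A1 := Poly [:: w ^+ 2 * - (nu * (1 + b)); w ^+ 2 * (1 + b - 2 * nu);
                    w ^+ 2 * (2 - nu); w ^+ 2].
pose A2 := Poly [:: z ^+ 2 * (nu * (1 + a)); z ^+ 2 * (1 + a - 2 * nu);
                    z ^+ 2 * (nu - 2); z ^+ 2].
pose Q := Poly [:: w ^+ 2 * (- (nu * (1 + b)) * (8 * c3))
                     - z ^+ 2 * (nu * (1 + a) * (8 * c3));
      w ^+ 2 * ((1 + b - 2 * nu) * (8 * c3) - nu * (1 + b) * (4 * c2))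
      + z ^+ 2 * (- (1 + a - 2 * nu) * (8 * c3) + nu * (1 + a) * (4 * c2));
      w ^+ 2 * ((2 - nu) * (8 * c3) + (1 + b - 2 * nu) * (4 * c2)
                - nu * (1 + b) * (2 * k))
      + z ^+ 2 * ((2 - nu) * (8 * c3) + (1 + a - 2 * nu) * (4 * c2)
                - nu * (1 + a) * (2 * k))].
exists ('X^i * Q + A1 * q1 + A2 * q2).
  apply: (leq_trans (size_polyD _ _)); rewrite geq_max; apply/andP; split.
    apply: (leq_trans (size_polyD _ _)); rewrite geq_max; apply/andP; split.
      apply: (leq_trans (size_polyMleq _ _)); rewrite size_polyXn /=.
      by rewrite -addn3 leq_add2l; apply: size_Poly.
    apply: (leq_trans (size_polyMleq _ _)).
    have szA : (size A1 <= 4)%N by apply: size_Poly.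
    by have := leq_add szA sz1; case: (_ + _)%N.
  apply: (leq_trans (size_polyMleq _ _)).
  have szA : (size A2 <= 4)%N by apply: size_Poly.
  by have := leq_add szA sz2; case: (_ + _)%N.
have -> : 'X^3 * contig_num i
  = ('X - nu%:P) * (w ^+ 2)%:P * (b%:P + ('X + 1%:P) ^+ 2) * ('X^3 * ('X + 2%:P) ^+ i)
  - s%:P * 'X^6 * 'X^i
  + ('X + nu%:P) * (z ^+ 2)%:P * (a%:P + ('X - 1%:P) ^+ 2) * ('X^3 * ('X - 2%:P) ^+ i)
  + (nu * twist_eval 2 'X^i)%:P * 'X^3.
  by rewrite /contig_num; ring.
rewrite polyCN in E2; rewrite E1 E2 cfE dfE efE /s -/k -/c2 -/c3.
congr (_ + _); rewrite /A1 /A2 /Q /= !cons_poly_def !mul0r !add0r.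
rewrite !exprD.
by ring.
Qed.

Lemma contig_num_coef i l : (i <= l)%N -> (0 < l)%N ->
  (contig_num i)`_l = up_coef i * (l == i.+2)%:R + diag_coef i * (l == i.+1)%:R
               + down_coef i * (l == i)%:R.
Proof.
move=> leil lp; have [q szq E] := contig_num_top i.
have -> : (contig_num i)`_l = ('X^3 * contig_num i)`_(l + 3).
  by rewrite coefXnM ltnNge leq_addl /= addnK.
rewrite E !coefD !coefCM !coefXn (nth_default 0 (leq_trans szq _)); last first.
  by rewrite -addn3 leq_add2r.
rewrite addr0 -[(i + 5)%N]/(i + (2 + 3))%N -[(i + 4)%N]/(i + (1 + 3))%N !addnA !eqn_add2r.
have -> : (l + 3 == 3)%N = false by lia.
by rewrite mulr0 addr0 addn2 addn1.
Qed.

Lemma contig_coef i l : (contig i)`_l = (contig_num i)`_l.+1.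
Proof. by rewrite coef_drop_poly addn1. Qed.

Lemma contig_high i l : (i.+1 < l)%N -> (contig i)`_l = 0.
Proof.
move=> lt_il; rewrite contig_coef contig_num_coef ?gtn_eqF ?mulr0 ?addr0 //; lia.
Qed.

Lemma contig_size i : (size (contig i) <= i.+2)%N.
Proof. by apply/leq_sizeP => l lt_il; rewrite contig_high. Qed.

Lemma contig_up i : (contig i)`_i.+1 = up_coef i.
Proof.
rewrite contig_coef contig_num_coef //; last by lia.
by rewrite eqxx [_ == i.+1]gtn_eqF // [_ == i]gtn_eqF // !mulr0 !addr0 mulr1.
Qed.

Lemma contig_diag i : (contig i)`_i = diag_coef i.
Proof.
rewrite contig_coef contig_num_coef // eqxx ltn_eqF // [_ == i]gtn_eqF //.
by rewrite !mulr0 addr0 add0r mulr1.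
Qed.

Lemma contig_down i : (contig i.+1)`_i = down_coef i.+1.
Proof.
rewrite contig_coef contig_num_coef // eqxx ltn_eqF; last by lia.
by rewrite ltn_eqF // !mulr0 !add0r mulr1.
Qed.

Lemma twist_eval_contig t i : t%:R * twist_eval t (contig i) =
  stepprod b t * w ^+ t * (contig_num i).[t%:R]
  + stepprod a t * (- z) ^+ t * (contig_num i).[- t%:R].
Proof. by rewrite /twist_eval -!contig_eval; ring. Qed.

(** The increasing enumeration of [n;m], which is the same for all m. *)
Definition slot j : nat := if (j < n)%N then j.+1 else (2 * j.+1 - n)%N.

Lemma slot_lt j : (j < n)%N -> slot j = j.+1.
Proof. by rewrite /slot => ->. Qed.

Lemma slot_ge j : (n <= j.+1)%N -> slot j = (2 * j.+1 - n)%N.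
Proof. by rewrite /slot; case: ltnP; lia. Qed.

Lemma slot_gt0 j : (0 < slot j)%N.
Proof. by rewrite /slot; case: (ltnP j n); lia. Qed.

Lemma slotS j : (n <= j.+1)%N -> slot j.+1 = (slot j).+2.
Proof. by move=> len; rewrite !slot_ge; lia. Qed.

Definition umemura_array i j : K := twist_eval (slot j) 'X^i.

Definition in_colspan (N : nat) (F : nat -> K) : Prop :=
  exists T : nat -> K, forall i, F i = \sum_(l < N) umemura_array i l * T l.

Lemma in_colspan0 N F : (forall i, F i = 0) -> in_colspan N F.
Proof.
by move=> F0; exists (fun=> 0) => i; rewrite F0 big1 // => l _; rewrite mulr0.
Qed.

Lemma in_colspanD N F F' : in_colspan N F -> in_colspan N F' ->
  in_colspan N (fun i => F i + F' i).
Proof.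
move=> [T FT] [T' FT']; exists (fun l => T l + T' l) => i.
by rewrite FT FT' -big_split; apply: eq_bigr => l _; rewrite mulrDr.
Qed.

Lemma in_colspanZ N c F : in_colspan N F -> in_colspan N (fun i => c * F i).
Proof.
move=> [T FT]; exists (fun l => c * T l) => i.
by rewrite FT mulr_sumr; apply: eq_bigr => l _; rewrite mulrCA.
Qed.

Lemma in_colspan_slot N l F :
  (l < N)%N -> (forall i, F i = umemura_array i l) -> in_colspan N F.
Proof.
move=> ltlN FG; exists (fun l' => (l' == l)%:R) => i.
rewrite (bigD1 (Ordinal ltlN)) //= eqxx mulr1 big1 ?addr0 ?FG // => l' nel.
suff /negPf->: (l' : nat) != l by rewrite mulr0.
by apply: contraNneq nel => eql; apply/eqP/val_inj.
Qed.

Lemma eq_in_colspan N F F' :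
  (forall i, F i = F' i) -> in_colspan N F -> in_colspan N F'.
Proof. by move=> FF [T FT]; exists T => i; rewrite -FF. Qed.

(** The multiple of the evaluation at -1 that the column t = 1 acquires. *)
Definition edge_coef : K := n%:R * z ^+ 2 * w * a * (b - a).

Section Span.
Variables m k : nat.
Hypothesis m0 : (0 < m)%N.
Hypothesis Nk : (n + m)%N = k.+1.

(** t+2 is again an index, unless t is the last one or t = n-1; in the second case
    the factor t - (n-1) vanishes. *)
Lemma span_up j : (j < k.+1)%N -> in_colspan k.+1 (fun i =>
  ((slot j)%:R - nu) * twist_eval (slot j).+2 'X^i
  - (j == k)%:R * (((slot j)%:R - nu) * umemura_array i k.+1)).
Proof.
move=> ltjN; case: (eqVneq j k) => [->|neq].
  apply: in_colspan0 => i; rewrite mul1r /umemura_array -slotS ?subrr //; lia.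
apply: (@eq_in_colspan _
  (fun i => ((slot j)%:R - nu) * twist_eval (slot j).+2 'X^i)) => [i|].
  by rewrite mul0r subr0.
case: (leqP n j.+1) => [len|ltn].
  apply: in_colspanZ; apply: (@in_colspan_slot _ j.+1) => [|i]; first by lia.
  by rewrite /umemura_array slotS.
case: (eqVneq j.+2 n) => [jn|nej].
  apply: in_colspan0 => i; rewrite slot_lt; last by lia.
  by rewrite /nu -jn -[j.+2%:R]natr1 addrK subrr mul0r.
apply: in_colspanZ; apply: (@in_colspan_slot _ j.+2) => [|i]; first by lia.
by rewrite /umemura_array !slot_lt //; lia.
Qed.

(** t-2 is again an index, or it is 0, where the functional vanishes. *)
Lemma span_down j t : (j < k.+1)%N -> slot j = t.+2 ->
  in_colspan k.+1 (fun i => twist_eval t 'X^i).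
Proof.
move=> ltjN; case: t => [|t] jt.
  by apply: in_colspan0 => i; rewrite twist_eval0X.
case: (ltnP j n) => [ltj|lenj].
  move: jt; rewrite slot_lt // => jt.
  apply: (@in_colspan_slot _ t) => [|i]; first by lia.
  by rewrite /umemura_array slot_lt //; lia.
move: jt; rewrite slot_ge; last by lia.
move=> jt; apply: (@in_colspan_slot _ j.-1) => [|i]; first by lia.
rewrite /umemura_array; congr (twist_eval _ _).
by rewrite /slot; case: (ltnP j.-1 n) => ?; lia.
Qed.

(** 2 is an index unless n = 1, where the factor n-1 vanishes. *)
Lemma span_two : in_colspan k.+1 (fun i => nu * twist_eval 2 'X^i).
Proof.
case: (eqVneq n 1%N) => [n1|n1].
  by apply: in_colspan0 => i; rewrite /nu n1 subrr mul0r.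
apply: in_colspanZ; apply: (@in_colspan_slot _ (n != 0%N)) => [|i].
  by case: eqP; lia.
rewrite /umemura_array; congr (twist_eval _ _); rewrite /slot.
by case: (n) n1 => [|[|?]].
Qed.

(** The relation between t+2, t and t-2, read modulo the span of the columns.  For
    t = 1 the term with t-2 = -1 evaluates at 1 and -1 with the weights of a and b
    interchanged; modulo the column t = 1 this is a multiple of the evaluation at
    -1. *)
Lemma contig_columns j : (j < k.+1)%N -> in_colspan k.+1 (fun i =>
  twist_eval (slot j) (contig i)
  - ((j == k)%:R * (((slot j)%:R - nu) / (slot j)%:R * umemura_array i k.+1)
     + ((j == 0%N) && (0 < n)%N)%:R * (edge_coef * (- 1) ^+ i))).
Proof.
move=> ltjN; set t := slot j.
have t0 : t%:R != 0 :> K by rewrite pnatr_eq0 -lt0n slot_gt0.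
(* [low] is the part that comes from p(y-2) at y = t and p(y+2) at y = -t *)
pose low i := (t%:R + nu) *
  (stepprod b t * w ^+ t * z ^+ 2 * (a + (t%:R - 1) ^+ 2) * (t%:R - 2) ^+ i
   - stepprod a t * (- z) ^+ t * w ^+ 2 * (b + (t%:R - 1) ^+ 2) * (2 - t%:R) ^+ i).
have expand i : t%:R * twist_eval t (contig i) =
  (t%:R - nu) * twist_eval t.+2 'X^i - s * t%:R ^+ 3 * twist_eval t 'X^i
  + (stepprod b t * w ^+ t + stepprod a t * (- z) ^+ t) * (nu * twist_eval 2 'X^i)
  + low i.
  rewrite twist_eval_contig !contig_num_eval (twist_evalX t.+2) !stepprodSS.
  rewrite (twist_evalX t) /low.
  have -> : t.+2%:R = t%:R + 2 :> K by rewrite -addn2 natrD.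
  have -> : - (t%:R + 2) = - t%:R - 2 :> K by ring.
  have -> : - t%:R + 2 = 2 - t%:R :> K by ring.
  move: ((t%:R + 2) ^+ i) ((t%:R - 2) ^+ i) ((2 - t%:R) ^+ i) ((- t%:R - 2) ^+ i).
  move=> e1 e2 e3 e4; move: (twist_eval 2 _) (t%:R ^+ i) ((- t%:R) ^+ i) => e5 e6 e7.
  by rewrite !exprS; ring.
have span_low : in_colspan k.+1 (fun i => low i
    - ((j == 0%N) && (0 < n)%N)%:R * (edge_coef * (- 1) ^+ i)).
  case: (eqVneq t 1%N) => [t1|t1].
    have /andP[/eqP j0 n0] : (j == 0%N) && (0 < n)%N.
      by move: t1; rewrite /t /slot; case: ltnP; lia.
    rewrite j0 n0 eqxx /=.
    apply: (@eq_in_colspan _ (fun i => n%:R * z * w * a * twist_eval 1 'X^i)) => [i|].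
      rewrite twist_evalX /low t1 -![1%:R]/(1 : K) !stepprod1 /edge_coef /nu.
      have -> : 1 - 2 = - 1 :> K by ring.
      have -> : 2 - 1 = 1 :> K by ring.
      by rewrite !expr1n; move: ((- 1) ^+ i) => e; ring.
    apply: in_colspanZ; apply: (@in_colspan_slot _ 0) => [|i]; first by lia.
    by rewrite /umemura_array slot_lt.
  have [t' tt'] : exists t', t = t'.+2.
    by exists t.-2; have := slot_gt0 j; rewrite -/t; lia.
  have -> : (j == 0%N) && (0 < n)%N = false.
    apply/negP=> /andP[/eqP j0 n0]; move: t1.
    by rewrite /t j0 slot_lt.
  apply: (@eq_in_colspan _ (fun i => (t%:R + nu) * w ^+ 2 * z ^+ 2
      * (a + (t%:R - 1) ^+ 2) * (b + (t%:R - 1) ^+ 2) * twist_eval t' 'X^i)) => [i|].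
    rewrite mul0r subr0 /low tt' twist_evalX !stepprodSS.
    have -> : t'.+2%:R = t'%:R + 2 :> K by rewrite -addn2 natrD.
    have -> : t'%:R + 2 - 2 = t'%:R :> K by ring.
    have -> : 2 - (t'%:R + 2) = - t'%:R :> K by ring.
    move: (t'%:R ^+ i) ((- t'%:R) ^+ i) => e1 e2.
    by rewrite !exprS; ring.
  by apply: in_colspanZ; apply: (span_down ltjN).
apply: (@eq_in_colspan _ (fun i => t%:R^-1 * (
   ((t%:R - nu) * twist_eval t.+2 'X^i
    - (j == k)%:R * ((t%:R - nu) * umemura_array i k.+1))
   + (- s * t%:R ^+ 3 * twist_eval t 'X^i)
   + (stepprod b t * w ^+ t + stepprod a t * (- z) ^+ t) * (nu * twist_eval 2 'X^i)
   + (low i - ((j == 0%N) && (0 < n)%N)%:R * (edge_coef * (- 1) ^+ i))))) => [i|].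
  apply: (mulfI t0); rewrite mulVKf // [RHS]mulrBr expand.
  have -> : t%:R * ((j == k)%:R * ((t%:R - nu) / t%:R * umemura_array i k.+1)
      + ((j == 0%N) && (0 < n)%N)%:R * (edge_coef * (- 1) ^+ i))
    = (j == k)%:R * ((t%:R - nu) * umemura_array i k.+1)
      + ((j == 0%N) && (0 < n)%N)%:R * (edge_coef * (- 1) ^+ i); last by ring.
  have [/andP[/eqP j0 n0]|_] := boolP ((j == 0%N) && (0 < n)%N); last first.
    by rewrite /= !mul0r !addr0; field.
  by rewrite /t j0 slot_lt //= !mul1r; field.
apply: in_colspanZ; apply: in_colspanD span_low.
apply: in_colspanD; last by apply: in_colspanZ; apply: span_two.
apply: in_colspanD; first exact: span_up.
by apply: in_colspanZ; apply: (@in_colspan_slot _ j).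
Qed.

End Span.
End Contiguity.

(** * The bilinear identity between minors *)

(** The sign of the cyclic permutation squares to 1, so it disappears from
    products of two rotated determinants. *)
Lemma ndet_rotate_cols (R : comNzRingType) k : exists2 e : R, e * e = 1 &
  forall F, ndet k.+1 F = e * ndet k.+1 (fun i j => F i (j.+1 %% k.+1)%N).
Proof.
pose p : 'S_k.+1 := perm (@ordS_inj k.+1).
exists ((-1) ^+ p) => [|F]; first by rewrite -expr2 sqrr_sign.
apply: (canRL (signrMK p)); rewrite -det_perm -[ndet _ F]ndet_tr -det_mulmx.
rewrite -row_permE -[RHS]ndet_tr; congr (\det _).
by apply/matrixP=> i j; rewrite !mxE permE.
Qed.

Section Bilinear.
Variables (K : numFieldType) (n m k : nat) (a b z w : K).
Hypothesis wz : w ^+ 2 = z ^+ 2 + 1.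
Hypothesis m0 : (0 < m)%N.
Hypothesis Nk : (n + m)%N = k.+1.

Let nu : K := n%:R - 1.
Let s : K := z ^+ 2 + w ^+ 2.
Let G := umemura_array n a b z w.
Let t j : K := (slot n j)%:R.
Let G' i j : K := if (j < k)%N then G i j.+1 else if j == k then G i 0%N else (-1) ^+ i.

(* In P and P1 the last column is replaced by the next one, in Q and Q1 the first
   column by the evaluation at -1; the suffix 1 marks the raised last row. *)
Let D := rdet0 k G.
Let D1 := rdet1 k G.
Let P := ndet k.+1 (fun i j => G i (skip k j)).
Let P1 := ndet k.+1 (fun i j => G (skip k i) (skip k j)).
Let Q := ndet k.+1 (setcol G 0 (fun i => (-1) ^+ i)).
Let Q1 := ndet k.+1 (setcol (fun i => G (skip k i)) 0 (fun i => (-1) ^+ (skip k i))).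
Let fq : K := (t k - nu) / t k.
Let kn : K := (0 < n)%:R * edge_coef n a b z w.

Lemma contiguity_matrix : exists T : nat -> nat -> K, forall i j, (j < k.+1)%N ->
  twist_eval a b z w (slot n j) (contig n a b z w i) =
  \sum_(l < k.+1) G i l * T l j
  + ((j == k)%:R * (fq * G i k.+1) + (j == 0%N)%:R * (kn * (-1) ^+ i)).
Proof.
have key (o : 'I_k.+1) := contig_columns a b z w m0 Nk (ltn_ord o).
have [f fE] := fin_all_exists key.
exists (fun l j => oapp (fun o => f o l) 0 (insub j)) => i j ltj.
have := fE (Ordinal ltj) i; rewrite insubT /= => /(canRL (subrK _)) ->.
congr (_ + (_ + _)).
  by case: eqP => [->|_]; rewrite ?mul0r.
by rewrite /kn; case: (j == 0%N) => /=; rewrite ?mul0r // ?mul1r mulrA.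
Qed.

(** The map r selects the rows; the same matrix T serves for D and for D1, so that
    its trace can be eliminated later. *)
Lemma contiguity_cols (r : nat -> nat) (T : nat -> nat -> K) :
  (forall i j, (j < k.+1)%N ->
  twist_eval a b z w (slot n j) (contig n a b z w i) =
  \sum_(l < k.+1) G i l * T l j
  + ((j == k)%:R * (fq * G i k.+1) + (j == 0%N)%:R * (kn * (-1) ^+ i))) ->
  ddet k.+1 (fun i => G (r i))
    (fun i j => twist_eval a b z w (slot n j) (contig n a b z w (r i)))
  = ndet k.+1 (fun i => G (r i)) * (\sum_(j < k.+1) T j j)
    + fq * ndet k.+1 (fun i j => G (r i) (skip k j))
    + kn * ndet k.+1 (setcol (fun i => G (r i)) 0 (fun i => (-1) ^+ (r i))).
Proof.
move=> TE; pose Gr i j := G (r i) j; rewrite -[fun i => G (r i)]/Gr.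
have -> : ddet k.+1 Gr
    (fun i j => twist_eval a b z w (slot n j) (contig n a b z w (r i)))
  = ddet k.+1 Gr (fun i j => \sum_(l < k.+1) Gr i l * T l j
  + ((j == k)%:R * (fq * G (r i) k.+1) + (j == 0%N)%:R * (kn * (-1) ^+ (r i)))).
  by apply: eq_ddet => // i j _ ltj; rewrite TE.
rewrite !ddetD (@ddet_mulr _ _ Gr T) -addrA; congr (_ + (_ + _)).
  rewrite ddet_col big_ord_recr /= big1 ?add0r => [|j _].
    rewrite eqxx (@ndet_setcolZ _ _ _ k 1 (fun i => fq * G (r i) k.+1)) // mul1r.
    rewrite (@ndet_setcolZ _ _ _ k fq (fun i => G (r i) k.+1)) //.
    congr (_ * _); apply: eq_ndet => i j _ _; rewrite /setcol /skip.
    by case: eqP.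
  rewrite ndet_setcol0 // => [|i]; first by rewrite ltnS ltnW.
  by rewrite ltn_eqF // mul0r.
rewrite ddet_col big_ord_recl /= big1 ?addr0 => [|j _].
  rewrite (@ndet_setcolZ _ _ _ 0 1%:R (fun i => kn * (-1) ^+ r i)) // mul1r.
  by rewrite (@ndet_setcolZ _ _ _ 0 kn (fun i => (-1) ^+ r i)).
rewrite ndet_setcol0 // => [|i]; first by rewrite /bump /= add1n ltnS.
by rewrite mul0r.
Qed.

Lemma twist_eval_contig_rows i j k' : (i.+1 < k')%N ->
  twist_eval a b z w (slot n j) (contig n a b z w i)
  = \sum_(l < k') (contig n a b z w i)`_l * G l j.
Proof.
by move=> lti; apply: twist_eval_sum; apply: leq_trans (contig_size n a b wz i) _.
Qed.

Lemma rdet11_up_coef : up_coef K n k.-1 * rdet11 k G = (up_coef K n k - 2) * rdet11 k G.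
Proof.
case: (posnP k) => [k0|kp].
  rewrite [rdet11 _ _]big1 ?mulr0 // => i /eqP ik.
  by have := etrans ik k0.
have kE : k%:R = k.-1%:R + 1 :> K by rewrite natr1 prednK.
by rewrite /up_coef kE; ring.
Qed.

(** X^2 takes the same value at t and -t, so raising all rows by two multiplies
    the column of t by t^2. *)
Lemma shift2_eigen : rdet2 k G - rdet11 k G = D * \sum_(j < k.+1) t j ^+ 2.
Proof.
rewrite -ddet_shift2 /D /rdet0 -(ddet_diag _ G (fun j => t j ^+ 2)).
apply: eq_ddet => // i j _ _.
rewrite /G /umemura_array !twist_evalX /t !exprS.
by move: (_ ^+ i) ((- (slot n j)%:R) ^+ i) => e e'; ring.
Qed.

(** R0 and R1 are the two evaluations of the trace for D and for D1.  In
    D R1 - D1 R0 the trace of T and most diagonal coefficients of [contig] cancel,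
    and [shift2_eigen] makes up for the difference between the coefficients of
    [rdet11] and [rdet2]. *)
Lemma bilinear_raw :
  fq * (ndet k G * ndet k.+2 G) + kn * (D * Q1 - D1 * Q)
  = up_coef K n k * (2 * s * D * D1 + D * (rdet11 k G + rdet2 k G) - D1 ^+ 2)
    + (2 * (\sum_(j < k.+1) t j ^+ 2) + down_coef n a b z w k.+1) * D ^+ 2.
Proof.
have [T TE] := contiguity_matrix.
pose M i l := (contig n a b z w i)`_l.
have M0 i l : (i.+1 < l)%N -> M i l = 0 by move=> lti; exact: contig_high.
have R0 := contiguity_cols id TE.
have R1 := contiguity_cols (skip k) TE.
rewrite (@ddet_rdet0 _ k G M) // in R0; last first.
  by move=> i j lei; apply: twist_eval_contig_rows.
rewrite (@ddet_rdet1 _ k G M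
  (fun i j => twist_eval a b z w (slot n j) (contig n a b z w i))) // in R1; last first.
  by move=> i j lei; apply: twist_eval_contig_rows.
rewrite /M !contig_up // in R0.
have upk : M k.-1 k * rdet11 k G = (up_coef K n k - 2) * rdet11 k G.
  rewrite -rdet11_up_coef; case: (posnP k) => [k0|kp].
    rewrite [rdet11 _ _]big1 ?mulr0 // => i /eqP ik.
    by have := etrans ik k0.
  by congr (_ * _); rewrite /M -{2}(prednK kp) contig_up.
rewrite upk /M contig_up // contig_down // contig_diag // in R1.
have dfS : diag_coef n a b z w k.+1 = diag_coef n a b z w k + 2 * s * up_coef K n k.
  by rewrite /diag_coef /up_coef -natr1 -/nu -/s; ring.
have cfS : up_coef K n k.+1 = up_coef K n k + 2 by rewrite /up_coef -natr1; ring.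
have E2 : rdet2 k G = rdet11 k G + D * \sum_(j < k.+1) t j ^+ 2.
  by rewrite -shift2_eigen; ring.
have sumS : \sum_(i < k.+1) M i i = \sum_(i < k) M i i + diag_coef n a b z w k.
  by rewrite big_ord_recr /= /M contig_diag.
rewrite -/(M _ _) in R0 R1.
rewrite sumS in R0; rewrite dfS cfS in R1.
rewrite -/D -/D1 -/P -/Q in R0; rewrite -/D -/D1 -/P1 -/Q1 in R1.
rewrite ndet_jacobi -/P -/P1 -/(rdet0 k G) -/(rdet1 k G) -/D -/D1.

rewrite -/(rdet0 k G) -/D in R0; rewrite -/(rdet1 k G) -/D1 in R1.
have {}R0 : fq * P
  = D * (\sum_(i < k) M i i + diag_coef n a b z w k) + up_coef K n k * D1
    - D * \sum_(j < k.+1) T j j - kn * Q by rewrite R0; ring.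
have {}R1 : fq * P1
  = D1 * (\sum_(i < k) M i i + (diag_coef n a b z w k + 2 * s * up_coef K n k))
    + (up_coef K n k - 2) * rdet11 k G + down_coef n a b z w k.+1 * D
    + (up_coef K n k + 2) * rdet2 k G
    - D1 * \sum_(j < k.+1) T j j - kn * Q1 by rewrite R1; ring.
have -> : fq * (D * P1 - P * D1) = D * (fq * P1) - D1 * (fq * P) by ring.
by rewrite R0 R1 E2; ring.
Qed.

Hypothesis n0 : (0 < n)%N.

(** With the column of t = 1 moved to the end, followed by the evaluation at -1,
    the left side has the form of the Desnanot-Jacobi identity. *)
Lemma boundary_jacobi : D * Q1 - D1 * Q = ndet k G' * ndet k.+2 G'.
Proof.
have [e ee rot] := ndet_rotate_cols K k.
have modk j : (j < k.+1)%N -> (j.+1 %% k.+1)%N = if (j < k)%N then j.+1 else 0%N.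
  move=> ltj; case: ltnP => [ltjk|lekj]; first by rewrite modn_small.
  have -> : j = k by apply/eqP; rewrite eqn_leq lekj andbT -ltnS.
  exact: modnn.
have EG (r : nat -> nat) : ndet k.+1 (fun i j => G (r i) (j.+1 %% k.+1)%N)
    = ndet k.+1 (fun i j => G' (r i) j).
  apply: eq_ndet => i j _ ltj; rewrite modk // /G'.
  case: (ltngtP j k) => // ltkj; by move: ltj; rewrite ltnS leqNgt ltkj.
have EQ (r : nat -> nat) : ndet k.+1 (fun i j =>
      setcol (fun i => G (r i)) 0 (fun i => (-1) ^+ r i) i (j.+1 %% k.+1)%N)
    = ndet k.+1 (fun i j => G' (r i) (skip k j)).
  apply: eq_ndet => i j _ ltj; rewrite modk // /G' /setcol /skip.
  case: (ltngtP j k) => [ltjk|ltkj|_] /=.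
  - by rewrite ltjk.
  - by move: ltj; rewrite ltnS leqNgt ltkj.
  - by rewrite ltnNge leqnSn /= gtn_eqF.
rewrite /D /D1 /rdet0 /rdet1 /Q /Q1 [ndet _ G]rot (EG id).
rewrite [ndet _ (fun i => G (skip k i))]rot (EG (skip k)).
rewrite [ndet _ (setcol G _ _)]rot (EQ id).
rewrite [ndet _ (setcol (fun i => G (skip k i)) _ _)]rot (EQ (skip k)).
rewrite ndet_jacobi.
have -> : forall x y u v : K, e * x * (e * y) - e * u * (e * v) = e * e * (x * y - u * v).
  by move=> *; ring.
by rewrite ee mul1r [X in _ = _ - X]mulrC.
Qed.

Lemma boundary_minor : ndet k G' = ndet k (fun i j => G i j.+1).
Proof. by apply: eq_ndet => i j _ ltj; rewrite /G' ltj. Qed.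

(** Two applications of [ndet_geometric_last], to the points -1 and 1, multiply
    the arguments of the functionals by X^2 - 1.  After the first of them the
    column of t = 1 is a multiple of the evaluation at 1, because the factor
    - 1 - X vanishes at -1. *)
Lemma boundary_major :
  ndet k.+2 G' = - 2 * b * w * (\prod_(j < k) (t j.+1 ^+ 2 - 1))
                 * ndet k (fun i j => G i j.+1).
Proof.
rewrite (@ndet_geometric_last _ k.+1 G' (-1)); last first.
  by move=> i; rewrite /G' ltnNge leqnSn /= gtn_eqF.
pose F i j : K := if (j < k)%N then - G i j.+1 - G i.+1 j.+1 else 1.
have -> : ndet k.+1 (fun i j => -1 * G' i j - G' i.+1 j)
    = ndet k.+1 (setcol F k (fun i => (-2 * b * w) * 1)).
  apply: eq_ndet => i j _ ltj; rewrite /setcol /F /G'.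
  case: (ltngtP j k) => [_|ltkj|_]; first by ring.
    by move: ltj; rewrite ltnS leqNgt ltkj.
  rewrite /G /umemura_array slot_lt // !twist_evalX !stepprod1.
  rewrite -![1%:R]/(1 : K) !expr1n [(-1) ^+ i.+1]exprS.
  by move: ((-1) ^+ i) => e; ring.
rewrite (@ndet_setcolZ _ _ F k (-2 * b * w) (fun=> 1)) //.
have -> : ndet k.+1 (setcol F k (fun=> 1)) = ndet k.+1 F.
  by apply: eq_ndet => i j _ _; rewrite /setcol /F; case: ltngtP.
rewrite (@ndet_geometric_last _ k F 1); last first.
  by move=> i; rewrite /F ltnn expr1n.
rewrite -[RHS]mulrA; congr (_ * _).
rewrite -(@ndet_scale_col _ k (fun i j => G i j.+1) (fun j => t j.+1 ^+ 2 - 1)).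
apply: eq_ndet => i j _ ltj; rewrite /F ltj /G /umemura_array !twist_evalX /t !exprS.
by move: (_ ^+ i) ((- (slot n j.+1)%:R) ^+ i) => e e'; ring.
Qed.

Lemma boundary_term : D * Q1 - D1 * Q =
  - 2 * b * w * (\prod_(j < k) (t j.+1 ^+ 2 - 1))
    * ndet k (fun i j => G i j.+1) ^+ 2.
Proof. by rewrite boundary_jacobi boundary_minor boundary_major; ring. Qed.

End Bilinear.

Lemma bilinear (K : numFieldType) (n m k : nat) (a b z w : K) :
  w ^+ 2 = z ^+ 2 + 1 -> (0 < m)%N -> (n + m)%N = k.+1 ->
  let G := umemura_array n a b z w in
  ((slot n k)%:R - (n%:R - 1)) / (slot n k)%:R * (ndet k G * ndet k.+2 G)
  = up_coef K n k * (2 * (z ^+ 2 + w ^+ 2) * rdet0 k G * rdet1 k G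
                + rdet0 k G * (rdet11 k G + rdet2 k G) - rdet1 k G ^+ 2)
    + (2 * (\sum_(j < k.+1) (slot n j)%:R ^+ 2) + down_coef n a b z w k.+1)
        * rdet0 k G ^+ 2
    + (0 < n)%:R * (2 * n%:R * a * b * (b - a) * z ^+ 2 * w ^+ 2
        * (\prod_(j < k) ((slot n j.+1)%:R ^+ 2 - 1))
        * ndet k (fun i j => G i j.+1) ^+ 2).
Proof.
move=> wz m0 Nk G; have /(canRL (addrK _)) -> := bilinear_raw a b wz m0 Nk.
rewrite -/G; congr (_ + _).
case: (posnP n) => [_|n0]; first by rewrite !mul0r oppr0.
by rewrite boundary_term //= -/G /edge_coef; ring.
Qed.

(** * Sums and products over the index set *)

Section SlotArithmetic.
Variables (K : numFieldType) (n : nat).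
Let t j : K := (slot n j)%:R.

Lemma slot_shift m : slot n (n + m) = (n + 2 * m + 2)%N.
Proof. by rewrite slot_ge; lia. Qed.

Lemma slot_shiftR m : t (n + m) = n%:R + 2 * m%:R + 2.
Proof. by rewrite /t slot_shift natrD natrD natrM. Qed.

Lemma slot_inc i j : (i < j)%N -> (slot n i < slot n j)%N.
Proof. by rewrite /slot; case: (ltnP i n); case: (ltnP j n); lia. Qed.

Lemma sum_slot m :
  2 * (\sum_(j < n + m) t j) = n%:R * (n%:R + 1) + 2 * m%:R * (n%:R + m%:R + 1).
Proof.
elim: m => [|m IH].
  rewrite addn0 !mulr0 mul0r addr0.
  have -> : \sum_(j < n) t j = \sum_(j < n) j.+1%:R.
    by apply: eq_bigr => j _; rewrite /t slot_lt.
  elim: (n) => [|p IH]; first by rewrite big_ord0 mulr0 mul0r.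
  by rewrite big_ord_recr /= mulrDr IH -natr1; ring.
rewrite addnS big_ord_recr /= mulrDr IH slot_shiftR.
by rewrite -[m.+1%:R]natr1; ring.
Qed.

Lemma sum_slot_sq m :
  6 * (\sum_(j < n + m) t j ^+ 2) = n%:R * (n%:R + 1) * (2 * n%:R + 1)
   + 6 * m%:R * n%:R ^+ 2 + 12 * n%:R * m%:R * (m%:R + 1)
   + 4 * m%:R * (m%:R + 1) * (2 * m%:R + 1).
Proof.
elim: m => [|m IH].
  rewrite addn0 !mulr0 !mul0r !addr0.
  have -> : \sum_(j < n) t j ^+ 2 = \sum_(j < n) j.+1%:R ^+ 2.
    by apply: eq_bigr => j _; rewrite /t slot_lt.
  elim: (n) => [|p IH]; first by rewrite big_ord0 mulr0 !mul0r.
  by rewrite big_ord_recr /= mulrDr IH -natr1; ring.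
rewrite addnS big_ord_recr /= mulrDr IH slot_shiftR.
by rewrite -[m.+1%:R]natr1; ring.
Qed.

(** The gaps to 1, ..., n form a quotient of factorials A, those to n+2, n+4, ...
    a multiple B of a factorial. *)
Lemma prod_slot_gap m :
  (2 * m%:R + 3) * (\prod_(i < n + m.+1) (t (n + m.+1) - t i))
  = (n%:R + 2 * m%:R + 3) * (n%:R + 2 * m%:R + 2)
    * (\prod_(i < n + m) (t (n + m) - t i)).
Proof.
pose A (q M : nat) : K := \prod_(i < q) (q%:R + M%:R - i%:R).
pose B (q : nat) : K := \prod_(i < q) (2 * (q%:R - i%:R)).
have AS q M : A q.+1 M = (q%:R + 1 + M%:R) * A q M.
  rewrite /A big_ord_recl subr0 -[q.+1%:R]natr1; congr (_ * _).
  by apply: eq_bigr => i _; rewrite lift0 -[i.+1%:R]natr1; ring.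
have BS q : B q.+1 = 2 * (q%:R + 1) * B q.
  rewrite /B big_ord_recl subr0 -[q.+1%:R]natr1; congr (_ * _).
  by apply: eq_bigr => i _; rewrite lift0 -[i.+1%:R]natr1; ring.
have AM q M : (M%:R + 1) * A q M.+1 = (q%:R + M%:R + 1) * A q M.
  elim: q => [|q IH]; first by rewrite /A !big_ord0 add0r.
  by rewrite !AS mulrCA IH -!natr1; ring.
have split_prod p : \prod_(i < n + p) (t (n + p) - t i) = A n (2 * p + 1)%N * B p.
  rewrite big_split_ord; congr (_ * _); apply: eq_bigr => i _ /=.
    by rewrite slot_shiftR /t slot_lt // natrD natrM -[i.+1%:R]natr1; ring.
  by rewrite !slot_shiftR; ring.
rewrite !split_prod BS.
have M1 : (2 * m.+1 + 1)%N = (2 * m + 1).+2 by lia.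
have := AM n (2 * m + 1)%N; have := AM n (2 * m + 1).+1.
rewrite M1 -[(2 * m + 1).+1%:R]natr1 natrD natrM => E1 E2.
set A2 := A n (2 * m + 1).+2 in E1 *; set A1 := A n (2 * m + 1).+1 in E1 E2.
set A0 := A n (2 * m + 1)%N in E2 *.
transitivity ((2 * m%:R + 1 + 1 + 1) * A2 * (2 * m%:R + 1 + 1) * B m); first by ring.
rewrite (_ : _ * A2 = (n%:R + (2 * m%:R + 1 + 1) + 1) * A1).
  rewrite (_ : _ * A1 * _ = (n%:R + (2 * m%:R + 1 + 1) + 1) * ((2 * m%:R + 1 + 1) * A1)).
    by rewrite E2; ring.
  by ring.
by rewrite -E1; ring.
Qed.

(** The quotient of the two products telescopes. *)
Lemma prod_slot_side n' m : n = n'.+1 ->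
  2 * (\prod_(j < n' + m) (t j.+1 + 1))
  = n%:R * (n%:R + 2 * m%:R + 1) * (\prod_(j < n' + m) (t j.+1 - 1)).
Proof.
move=> nE; elim: m => [|m IH].
  rewrite addn0 mulr0 addr0.
  have base p : (p <= n')%N -> 2 * (\prod_(j < p) (t j.+1 + 1))
      = (p%:R + 1) * (p%:R + 2) * (\prod_(j < p) (t j.+1 - 1)).
    elim: p => [|p IH] lep; first by rewrite !big_ord0; ring.
    rewrite !big_ord_recr /= mulrA IH ?(ltnW lep) // /t slot_lt; last by lia.
    by rewrite -[p.+2%:R]natr1 -[p.+1%:R]natr1; ring.
  by rewrite base // nE -[n'.+1%:R]natr1; congr (_ * _); ring.
rewrite addnS !big_ord_recr /= mulrA IH.
have -> : t (n' + m).+1 = n%:R + 2 * m%:R + 2.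
  by rewrite -slot_shiftR nE.
by rewrite -[m.+1%:R]natr1; ring.
Qed.

(** The left side comes from the coefficient of U^2 in the theorem and from the
    Hirota derivative, the right side from [shift2_eigen] and [down_coef]. *)
Lemma slot_weight_identity m : let c : K := n%:R + 2 * m%:R + 1 in
  let N : K := n%:R + m%:R in
  c * (c ^+ 2 - 1) - 2 * c * (\sum_(j < n + m) t j)
  = 2 * (\sum_(j < n + m) t j ^+ 2) + 4 / 3 * N * (N ^+ 2 - 1)
    - 2 * (n%:R - 1) * N * (N + 1).
Proof.
move=> c N.
have two0 : 2 != 0 :> K by rewrite pnatr_eq0.
have six0 : 6 != 0 :> K by rewrite pnatr_eq0.
have -> := canRL (mulKf two0) (sum_slot m).
have -> := canRL (mulKf six0) (sum_slot_sq m).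
by rewrite /c /N; field.
Qed.

End SlotArithmetic.

(** * Normalization by Vandermonde determinants *)

Definition vdm (R : comNzRingType) (t : nat -> R) (k : nat) : R :=
  \prod_(j < k) \prod_(i < j) (t j - t i).

Lemma vdmS (R : comNzRingType) (t : nat -> R) k :
  vdm t k.+1 = vdm t k * \prod_(i < k) (t k - t i).
Proof. by rewrite /vdm big_ord_recr. Qed.

Section Toda.
Variables (K : numFieldType) (n m k : nat) (a b z w : K).
Hypothesis wz : w ^+ 2 = z ^+ 2 + 1.
Hypothesis m0 : (0 < m)%N.
Hypothesis Nk : (n + m)%N = k.+1.

Let s : K := z ^+ 2 + w ^+ 2.
Let G := umemura_array n a b z w.
Let t j : K := (slot n j)%:R.
Let V := vdm t k.+1.
Let X := rdet0 k G / V.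
Let Y := rdet1 k G / V.
Let Z := (rdet11 k G + rdet2 k G) / V.
Let sigma : K := \sum_(j < k.+1) t j.
Let U1 : K := (\prod_(j < k) ((t j.+1 + 1) / (t j.+1 - 1)))
   * ndet k (fun i j => G i j.+1) / vdm (fun j => t j.+1) k.

Lemma slot_diff_neq0 i j : (i < j)%N -> t j - t i != 0.
Proof.
move=> ltij; have lt := slot_inc n ltij.
by rewrite /t -natrB ?(ltnW lt) // pnatr_eq0 subn_eq0 -ltnNge.
Qed.

Lemma vdm_slot_neq0 l p : vdm (fun j => t (l + j)%N) p != 0.
Proof.
apply/prodf_neq0 => j _; apply/prodf_neq0 => i _.
by rewrite slot_diff_neq0 // ltn_add2l.
Qed.

Lemma vdm_first p : (0 < n)%N ->
  vdm t p.+1 = vdm (fun j => t j.+1) p * \prod_(j < p) (t j.+1 - 1).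
Proof.
move=> n0; have t0 : t 0%N = 1 by rewrite /t slot_lt.
elim: p => [|p IH].
  by rewrite vdmS /vdm !big_ord0 !mulr1.
rewrite vdmS IH vdmS big_ord_recl big_ord_recr /= t0.
have -> : \prod_(i < p) (t p.+1 - t (bump 0 i)) = \prod_(i < p) (t p.+1 - t i.+1) by [].
by ring.
Qed.

(** [bilinear] divided by the Vandermonde determinants.  The square of the minor
    without the column t = 1 carries the product of t^2 - 1 over the other t.
    Divided by V^2, this product is the square of the normalization of U^(1) up to
    a factor in n and n + 2m + 1, by [prod_slot_side]. *)
Lemma toda_determinants :
  ndet k G / vdm t k * (ndet k.+2 G / vdm t k.+2)
  = (- bar a (n + 2 * m + 2) * z ^+ 2 + bar b (n + 2 * m + 2) * w ^+ 2) * X ^+ 2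
    + (X * Z - Y ^+ 2 + 2 * s * X * Y - 2 * sigma * X ^+ 2)
    - (0 < n)%:R * (4 / (n + 2 * m + 1)%:R ^+ 2 * a * b * (a - b) * z ^+ 2 * w ^+ 2
         * U1 ^+ 2).
Proof.
have raw := bilinear a b wz m0 Nk.
set c : K := n%:R + 2 * m%:R + 1.
have cE : (n + 2 * m + 1)%:R = c by rewrite /c natrD natrD natrM.
have c0 : c != 0 by rewrite -cE pnatr_eq0 addn1.
have mR : m%:R = m.-1%:R + 1 :> K by rewrite natr1 prednK.
have kR : k.+1%:R = n%:R + m%:R :> K by rewrite -Nk natrD.
have k1R : k%:R = n%:R + m%:R - 1 :> K by rewrite -kR -natr1 addrK.
have cfE : up_coef K n k = c by rewrite /up_coef k1R /c; ring.
have tk : t k = n%:R + 2 * m%:R.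
  have kE : k = (n + m.-1)%N by apply: succn_inj; rewrite -Nk -addnS prednK.
  by rewrite /t kE slot_shiftR mR; ring.
have tk0 : t k != 0 by rewrite pnatr_eq0 -lt0n slot_gt0.
pose Pp := \prod_(i < k.+1) (t k.+1 - t i); pose Pq := \prod_(i < k) (t k - t i).
have gap : (t k - (n%:R - 1)) / t k * Pp = c * Pq.
  have := prod_slot_gap K n m.-1; rewrite prednK // Nk.
  have -> : (n + m.-1)%N = k by apply: succn_inj; rewrite -Nk -addnS prednK.
  rewrite -/Pp -/Pq => E; apply: (mulIf tk0); rewrite mulrAC divfK //.
  have -> : t k - (n%:R - 1) = 2 * m.-1%:R + 3 by rewrite tk mR; ring.
  by rewrite E tk /c mR; ring.
have V0 : V != 0 := vdm_slot_neq0 0 k.+1.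
have Vk0 : vdm t k != 0 := vdm_slot_neq0 0 k.
have Pp0 : Pp != 0 by apply/prodf_neq0 => i _; apply: slot_diff_neq0.
have Pq0 : Pq != 0 by apply/prodf_neq0 => i _; apply: slot_diff_neq0.
have VE : V = vdm t k * Pq by rewrite /V vdmS.
have V2E : vdm t k.+2 = V * Pp by rewrite vdmS.
have left_side : ndet k G / vdm t k * (ndet k.+2 G / vdm t k.+2)
    = ((t k - (n%:R - 1)) / t k * (ndet k G * ndet k.+2 G)) / (c * V ^+ 2).
  have -> : (t k - (n%:R - 1)) / t k = c * Pq / Pp by rewrite -gap mulfK.
  by rewrite V2E VE; field; rewrite Vk0 Pq0 Pp0 c0.
rewrite left_side raw -/G cfE /X /Y /Z.
have weights : 2 * (\sum_(j < k.+1) t j ^+ 2) + down_coef n a b z w k.+1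
    = c * (- bar a (n + 2 * m + 2) * z ^+ 2 + bar b (n + 2 * m + 2) * w ^+ 2
           - 2 * sigma).
  have := slot_weight_identity K n m; rewrite /= -/c Nk -/sigma.
  have -> : bar a (n + 2 * m + 2) = a + c ^+ 2.
    by rewrite /bar natrD natrD natrM /c; ring.
  have -> : bar b (n + 2 * m + 2) = b + c ^+ 2.
    by rewrite /bar natrD natrD natrM /c; ring.
  rewrite /down_coef kR => E.
  have -> : c * (- (a + c ^+ 2) * z ^+ 2 + (b + c ^+ 2) * w ^+ 2 - 2 * sigma)
     = c * (c ^+ 2 - 1) - 2 * c * sigma + c * (1 + b * w ^+ 2 - a * z ^+ 2).
    by rewrite wz; ring.
  by rewrite E /c wz; field.
rewrite -/t weights.
have last_term : (0 < n)%:R * (2 * n%:R * a * b * (b - a) * z ^+ 2 * w ^+ 2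
        * (\prod_(j < k) (t j.+1 ^+ 2 - 1))
        * ndet k (fun i j => G i j.+1) ^+ 2) / (c * V ^+ 2)
  = - ((0 < n)%:R * (4 / c ^+ 2 * a * b * (a - b) * z ^+ 2 * w ^+ 2 * U1 ^+ 2)).
  case: (posnP n) => [_|n0]; first by rewrite !mul0r oppr0.
  rewrite !mul1r /U1 prodf_div.
  set E := ndet k _; set V' := vdm (fun j => t j.+1) k.
  pose Pm := \prod_(j < k) (t j.+1 - 1); pose Pl := \prod_(j < k) (t j.+1 + 1).
  have -> : \prod_(j < k) (t j.+1 ^+ 2 - 1) = Pm * Pl.
    by rewrite /Pm /Pl -big_split; apply: eq_bigr => j _ /=; ring.
  rewrite -/Pm -/Pl.
  have Pm0 : Pm != 0.
    apply/prodf_neq0 => j _; have := @slot_diff_neq0 0 j.+1 isT.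
    by rewrite [t 0%N](_ : _ = 1) // /t slot_lt.
  have V'0 : V' != 0 := vdm_slot_neq0 1 k.
  have side : 2 * Pl = n%:R * c * Pm.
    have := @prod_slot_side K n n.-1 m (esym (prednK n0)).
    by have -> : (n.-1 + m)%N = k by apply: succn_inj; rewrite -Nk -addSn prednK.
  have two0 : 2 != 0 :> K by rewrite pnatr_eq0.
  have -> := canRL (mulKf two0) side.
  have -> : V = V' * Pm by rewrite /V vdm_first.
  by field; rewrite Pm0 V'0 c0.
rewrite cE -last_term mulrDl; congr (_ + _).
by rewrite /s; field; rewrite V0 c0.
Qed.

End Toda.

(** * Expansion over the choice of signs *)

(** J is the set of columns in which the point -t is chosen.  The function is
    defined on all naturals in order to serve in arrays. *)
Definition flip (R : comNzRingType) k (J : {set 'I_k}) (t : nat -> R) (j : nat) : R :=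
  if j \in image val J then - t j else t j.

Lemma flip_ord (R : comNzRingType) k (J : {set 'I_k}) (t : nat -> R) (j : 'I_k) :
  flip J t j = if j \in J then - t j else t j.
Proof. by rewrite /flip (mem_image val_inj). Qed.

Lemma ndet_slater (R : comNzRingType) k (al be t : nat -> R) (r : nat -> nat) :
  ndet k (fun i j => be j * t j ^+ r i + al j * (- t j) ^+ r i)
  = \sum_(J : {set 'I_k}) (\prod_(j in J) al j) * (\prod_(j in ~: J) be j)
      * ndet k (fun i j => flip J t j ^+ r i).
Proof.
rewrite /ndet {1}/determinant.
transitivity (\sum_(s : 'S_k) \sum_(J : {set 'I_k})
   (\prod_(j in J) al j) * (\prod_(j in ~: J) be j)
   * ((-1) ^+ s * \prod_(j < k) flip J t j ^+ r (s j))).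
  rewrite (reindex_inj invg_inj); apply: eq_bigr => s _.
  rewrite odd_permV (reindex_inj (@perm_inj _ s)) /=.
  under eq_bigr do rewrite mxE permK addrC.
  rewrite bigA_distr mulr_sumr; apply: eq_bigr => J _.
  rewrite mulrCA; congr (_ * _).
  rewrite [X in _ = X * _](_ : _ = \prod_(j < k) (if j \in J then al j else be j)).
    rewrite -big_split; apply: eq_bigr => j _ /=; rewrite flip_ord.
    by case: ifP.
  rewrite [RHS](bigID (mem J)) /=; congr (_ * _).
    by apply: eq_bigr => j ->.
  by apply: eq_big => [j|j]; rewrite inE // => /negPf ->.
rewrite exchange_big; apply: eq_bigr => J _ /=.
rewrite -mulr_sumr; congr (_ * _).
rewrite -[RHS]det_tr; apply: eq_bigr => s _; congr (_ * _).
by apply: eq_bigr => j _; rewrite !mxE.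
Qed.

Lemma ndet_vdm (R : comNzRingType) k (x : nat -> R) :
  ndet k (fun i j => x j ^+ i) = vdm x k.
Proof.
have := @det_Vandermonde R k (\row_j x j).
rewrite (_ : Vandermonde _ _ = natmx k (fun i j => x j ^+ i)); last first.
  by apply/matrixP=> i j; rewrite !mxE.
rewrite -/(ndet _ _) => ->; rewrite /vdm (exchange_big_dep predT) //=.
apply: eq_bigr => j _; rewrite (big_ord_widen_cond k (fun=> true)
  (fun i => x j - x i) (ltnW (ltn_ord j))) /=.
by apply: eq_bigr => i _; rewrite !mxE.
Qed.

Section VandermondeShift.
Variables (R : comNzRingType) (k : nat) (x : nat -> R).
Let X i j := x j ^+ i.

(** Multiplying the argument by X scales each column of a Vandermonde matrix by
    its point; raising the last row therefore multiplies the determinant by the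
    sum of the points. *)
Lemma vdm_rdet1 : rdet1 k X = vdm x k.+1 * \sum_(j < k.+1) x j.
Proof.
rewrite -ddet_shift_rdet0 -ndet_vdm -ddet_diag.
by apply: eq_ddet => // i j _ _; rewrite /X exprS.
Qed.

Lemma vdm_rdet2 : rdet11 k X + rdet2 k X = vdm x k.+1 * (\sum_(j < k.+1) x j) ^+ 2.
Proof.
rewrite expr2 mulrA -vdm_rdet1 -ddet_shift_rdet1 /rdet1 -ddet_diag.
by apply: eq_ddet => // i j _ _; rewrite /X exprS.
Qed.
End VandermondeShift.

Section SlaterRaised.
Variables (R : comNzRingType) (k : nat) (al be t : nat -> R).
Let G i j := be j * t j ^+ i + al j * (- t j) ^+ i.
Let coef (J : {set 'I_k.+1}) := (\prod_(j in J) al j) * (\prod_(j in ~: J) be j).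
Let u J := coef J * vdm (flip J t) k.+1.
Let e (J : {set 'I_k.+1}) := \sum_(j < k.+1) flip J t j.

Lemma slater_rdet0 : rdet0 k G = \sum_J u J.
Proof.
by rewrite /rdet0 (ndet_slater _ al be t id); apply: eq_bigr => J _; rewrite ndet_vdm.
Qed.

Lemma slater_rdet1 : rdet1 k G = \sum_J e J * u J.
Proof.
rewrite /rdet1 (ndet_slater _ al be t (skip k)); apply: eq_bigr => J _.
rewrite -[ndet _ _]/(rdet1 k (fun i j => flip J t j ^+ i)) vdm_rdet1.
by rewrite /u /e -/(coef J); ring.
Qed.

Lemma slater_rdet2 : rdet11 k G + rdet2 k G = \sum_J e J ^+ 2 * u J.
Proof.
pose X (J : {set 'I_k.+1}) i j := flip J t j ^+ i : R.
have E2 : rdet2 k G = \sum_J coef J * rdet2 k (X J).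
  pose r i := if i == k then k.+2 else i.
  transitivity (ndet k.+1 (fun i j => G (r i) j)).
    by apply: eq_ndet => i j _ _; rewrite /setrow /r; case: eqP.
  rewrite (ndet_slater _ al be t r); apply: eq_bigr => J _; congr (_ * _).
  by apply: eq_ndet => i j _ _; rewrite /setrow /r /X; case: eqP.
have E11 : rdet11 k G = \sum_J coef J * rdet11 k (X J).
  rewrite /rdet11; under [RHS]eq_bigr do rewrite mulr_sumr.
  rewrite [RHS]exchange_big /=; apply: eq_bigr => i0 _.
  pose r (i : nat) := if i == i0 then k else skip k i.
  transitivity (ndet k.+1 (fun i j => G (r i) j)).
    by apply: eq_ndet => i j _ _; rewrite /setrow /r; case: eqP.
  rewrite (ndet_slater _ al be t r); apply: eq_bigr => J _; congr (_ * _).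
  by apply: eq_ndet => i j _ _; rewrite /setrow /r /X; case: eqP.
rewrite E11 E2 -big_split; apply: eq_bigr => J _ /=.
by rewrite -mulrDr vdm_rdet2 /u /e; ring.
Qed.
End SlaterRaised.

Section FlipVandermonde.
Variables (C : numFieldType) (k : nat) (t : nat -> nat).
Hypothesis t_inc : forall i j, (i < j)%N -> (t i < t j)%N.
Let tr j : C := (t j)%:R.
Let rho (i j : nat) : C := `|(tr i + tr j) / (tr i - tr j)|.

Lemma rho_sym i j : rho i j = rho j i.
Proof. by rewrite /rho addrC -[tr i - tr j]opprB invrN mulrN normrN. Qed.

Lemma rho_lt i j : (i < j)%N -> rho i j = (tr i + tr j) / (tr j - tr i).
Proof.
move=> ltij; rewrite rho_sym /rho addrC ger0_norm // divr_ge0 //.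
  by rewrite addr_ge0 ?ler0n.
by rewrite subr_ge0 ler_nat ltnW // t_inc.
Qed.

(** In the factor x_j - x_i with i < j, flipping j contributes the sign -1 and
    flipping exactly one of i, j contributes rho i j.  There are j factors for
    each j. *)
Lemma vdm_flip (J : {set 'I_k}) :
  vdm (flip J tr) k = vdm tr k * (\prod_(j in J) (-1) ^+ j)
                      * \prod_(i in J) \prod_(j in ~: J) rho i j.
Proof.
(* f i j is rho i j if exactly i is flipped; both orders occur in the product *)
pose f (i j : 'I_k) := if (i \in J) && (j \notin J) then rho i j else 1.
have vdmE (x : nat -> C) : vdm x k = \prod_(j < k) \prod_(i < k | (i < j)%N) (x j - x i).
  apply: eq_bigr => j _.
  by rewrite (big_ord_widen_cond k (fun=> true) (fun i => x j - x i) (ltnW (ltn_ord j))).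
rewrite !vdmE.
have -> : \prod_(i in J) \prod_(j in ~: J) rho i j
    = \prod_(j < k) \prod_(i < k | (i < j)%N) (f i j * f j i).
  transitivity (\prod_(i < k) \prod_(j < k) f i j).
    rewrite big_mkcond; apply: eq_bigr => i _; rewrite /f; case: ifP => iJ /=.
      by rewrite big_mkcond; apply: eq_bigr => j _; rewrite inE.
    by rewrite big1.
  under [RHS]eq_bigr do rewrite big_split /=.
  rewrite big_split /= [X in _ = _ * X](exchange_big_dep predT) //= exchange_big -big_split.
  apply: eq_bigr => j _ /=; rewrite (bigID (fun i : 'I_k => (i < j)%N)) /=.
  congr (_ * _); rewrite [RHS]big_mkcond [LHS]big_mkcond; apply: eq_bigr => i _.
  rewrite -leqNgt leq_eqVlt; case: eqP => [/val_inj ->|_] //=.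
  by rewrite ltnn /f andbN.
have -> : \prod_(j in J) (-1) ^+ j
    = \prod_(j < k) \prod_(i < k | (i < j)%N) (if j \in J then -1 else 1) :> C.
  rewrite big_mkcond; apply: eq_bigr => j _; case: ifP => jJ; last by rewrite big1.
  rewrite -(big_ord_widen_cond k (fun=> true) (fun=> -1) (ltnW (ltn_ord j))).
  by rewrite prodr_const card_ord.
rewrite -!big_split; apply: eq_bigr => j _ /=; rewrite -!big_split.
apply: eq_bigr => i ltij /=; rewrite !flip_ord /f.
have nz : tr j - tr i != 0.
  by rewrite /tr -natrB ?(ltnW (t_inc ltij)) // pnatr_eq0 subn_eq0 -ltnNge t_inc.
case: (i \in J); case: (j \in J); rewrite /= ?[rho j i]rho_sym ?rho_lt //.
- by ring.
- by field.
- by field.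
by ring.
Qed.
End FlipVandermonde.

(** * Umemura polynomials as determinants *)

Section Indices.
Variables (n m q p : nat).
Hypothesis leqn : (q <= n)%N.
Hypothesis qp : (q + p = n + m)%N.

Definition slot_ord (j : 'I_p) : 'I_(n + 2 * m).+1 := inord (slot n (q + j)).

Lemma val_slot_ord j : slot_ord j = slot n (q + j) :> nat.
Proof.
rewrite /slot_ord inordK // /slot; have := ltn_ord j.
by case: (ltnP (q + j) n); lia.
Qed.

Lemma slot_ord_inj : injective slot_ord.
Proof.
move=> i j /(congr1 val); rewrite /= !val_slot_ord => eq_ij; apply/val_inj => /=.
case: (ltngtP i j) => // lt; move: eq_ij.
  by have /(slot_inc n) : (q + i < q + j)%N by [rewrite ltn_add2l]; lia.
by have /(slot_inc n) : (q + j < q + i)%N by [rewrite ltn_add2l]; lia.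
Qed.

Lemma slot_ord_gt j : (q < slot_ord j)%N.
Proof. by rewrite val_slot_ord /slot; case: (ltnP (q + j) n); lia. Qed.

Lemma slot_ord_notin_init j : slot_ord j \notin initseg n m q.
Proof.
by rewrite inE negb_and -leqNgt -[(slot_ord j <= q)%N]negbK -ltnNge slot_ord_gt orbT.
Qed.

Lemma slot_ord_in_brack j : slot_ord j \in brack n m.
Proof.
rewrite inE val_slot_ord /slot; have := ltn_ord j.
by case: (ltnP (q + j) n); lia.
Qed.

Lemma init_sub_brack : initseg n m q \subset brack n m.
Proof. by apply/subsetP => i; rewrite !inE; lia. Qed.

Lemma brack_posP i : i \in brack n m -> i \notin initseg n m q -> exists j, i = slot_ord j.
Proof.
rewrite !inE => ib iq.
pose j := (if (i <= n)%N then i.-1 - q else (i - n)./2 + n - q.+1)%N.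
have ltj : (j < p)%N.
  by have := ltn_ord i; move: ib iq; rewrite /j; case: (leqP i n); lia.
exists (Ordinal ltj); apply/val_inj; rewrite /= val_slot_ord /= /slot.
move: ib iq; rewrite /j; case: (leqP i n) => lein ib iq.
  by case: (ltnP (q + (i.-1 - q)) n); lia.
by case: (ltnP (q + ((i - n)./2 + n - q.+1)) n); lia.
Qed.

Lemma brack_split : brack n m = initseg n m q :|: [set slot_ord j | j : 'I_p].
Proof.
apply/setP => i; rewrite in_setU; apply/idP/idP => [ib|].
  case: (boolP (i \in initseg n m q)) => //= iq.
  by have [j ->] := brack_posP ib iq; apply/imsetP; exists j.
case/orP => [|/imsetP[j _ ->]]; last exact: slot_ord_in_brack.
exact/subsetP/init_sub_brack.
Qed.

Lemma init_disj (J : {set 'I_p}) : [disjoint initseg n m q & slot_ord @: J].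
Proof.
rewrite disjoint_sym disjoint_subset; apply/subsetP => i /imsetP[j _ ->].
by rewrite inE slot_ord_notin_init.
Qed.

Lemma select_minus_init (J : {set 'I_p}) :
  (initseg n m q :|: slot_ord @: J) :\: initseg n m q = slot_ord @: J.
Proof.
rewrite setDUl setDv set0U; apply/setDidPl.
by rewrite disjoint_sym init_disj.
Qed.

Lemma brack_minus_select (J : {set 'I_p}) :
  brack n m :\: (initseg n m q :|: slot_ord @: J) = slot_ord @: ~: J.
Proof.
rewrite brack_split; apply/setP => i; rewrite !inE negb_or.
apply/idP/imsetP => [|[j]].
  case/andP => /andP[/negPf iq iJ] /orP[|/imsetP[j _ ij]].
    by rewrite iq.
  exists j => //; rewrite inE; apply: contra iJ => jJ.
  by rewrite ij imset_f.
rewrite inE => jJ ->; have := slot_ord_notin_init j; rewrite inE => -> /=.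
by rewrite mem_imset ?jJ ?imset_f ?orbT //; apply: slot_ord_inj.
Qed.

Lemma big_select (R : Type) (idx : R) (op : Monoid.com_law idx) F (J : {set 'I_p}) :
  \big[op/idx]_(i in initseg n m q :|: slot_ord @: J) F i
  = op (\big[op/idx]_(i in initseg n m q) F i) (\big[op/idx]_(j in J) F (slot_ord j)).
Proof.
rewrite -(@big_imset _ _ _ _ _ slot_ord J) => [|i j _ _]; last exact: slot_ord_inj.
by rewrite -bigU ?init_disj //; apply: eq_bigl => i; rewrite in_setU.
Qed.

Lemma reindex_select (R : nmodType) (F : {set 'I_(n + 2 * m).+1} -> R) :
  \sum_(I : {set 'I_(n + 2 * m).+1}
          | (initseg n m q \subset I) && (I \subset brack n m)) F I
  = \sum_(J : {set 'I_p}) F (initseg n m q :|: slot_ord @: J).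
Proof.
rewrite (reindex_onto (fun J : {set 'I_p} => initseg n m q :|: slot_ord @: J)
                      (fun I => slot_ord @^-1: I)) /=.
  apply: eq_bigl => J; rewrite subsetUl subUset init_sub_brack /=.
  apply/andP; split.
    by apply/subsetP => i /imsetP[j _ ->]; apply: slot_ord_in_brack.
  apply/eqP/setP => j; rewrite !inE mem_imset; last exact: slot_ord_inj.
  by have := slot_ord_notin_init j; rewrite inE => /negPf ->.
move=> I /andP[initI Ibrack]; apply/setP => i; rewrite inE.
case: (boolP (i \in initseg n m q)) => [iq|iq] /=.
  by rewrite (subsetP initI).
apply/imsetP/idP => [[j]|iI]; first by rewrite inE => jI ->.
have [j ij] := brack_posP (subsetP Ibrack _ iI) iq.
by exists j => //; rewrite inE -ij.
Qed.

End Indices.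

Section UmemuraSlater.
Variables (C : numFieldType) (n m q p : nat) (a b z w : C).
Hypothesis leqn : (q <= n)%N.
Hypothesis qp : (q + p = n + m)%N.
Let t j := slot n (q + j).
Let tr j : C := (t j)%:R.
Let al j := - (stepprod a (t j) * (- z) ^+ t j).
Let be j := stepprod b (t j) * w ^+ t j.

Local Notation ps := (@slot_ord n m q p).

(** What the indices of [q] contribute to the factors of an index x outside [q]. *)
Definition cross (x : C) : C := \prod_(l in initseg n m q) ((x + l%:R) / (x - l%:R)).

Lemma card_init : #|initseg n m q| = q.
Proof.
have -> : initseg n m q = [set inord j.+1 | j : 'I_q].
  apply/setP => i; rewrite inE; apply/idP/imsetP => [iq|[j _ ->]].
    have ltj : (i.-1 < q)%N by lia.
    exists (Ordinal ltj) => //; apply/val_inj; rewrite /= inordK; lia.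
  have ltj := ltn_ord j; rewrite inordK; lia.
rewrite card_imset ?card_ord // => i j /(congr1 val) /=.
have [lti ltj] := (ltn_ord i, ltn_ord j).
rewrite !inordK => [[eq_ij]||]; [exact: val_inj | lia | lia].
Qed.

(** An index outside [q] has the same factor [cross] whether it is selected, by the
    explicit product, or not, by d(I); hence these factors come out of the sum.
    The sign (-1)^q of the explicit product and (-1)^c(I) combine, for the selected
    index t in position j, to - (-1)^t (-1)^j.  Here - (-1)^t belongs to the
    functional [twist_eval] and (-1)^j to the Vandermonde determinant by
    [vdm_flip]. *)
Lemma umemura_slater :
  umemura n m q a b z w = (\prod_(j < p) cross (tr j)) *
    \sum_(J : {set 'I_p}) (\prod_(j in J) al j) * (\prod_(j in ~: J) be j)
        * vdm (flip J tr) p / vdm tr p.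
Proof.
rewrite /umemura leqn (reindex_select leqn qp) mulr_sumr.
apply: eq_bigr => J _.
rewrite select_minus_init // brack_minus_select //.
have im F (A : {set 'I_p}) :
    \prod_(i in ps @: A) F i = \prod_(j in A) F (ps j) :> C.
  by rewrite big_imset //= => i j _ _; apply: slot_ord_inj.
have trE (j : 'I_p) : (ps j)%:R = tr j by rewrite val_slot_ord.
have cross_in : \prod_(i in ps @: J) \prod_(j in initseg n m q)
    ((i%:R + j%:R) / (j%:R - i%:R)) = \prod_(j in J) ((-1) ^+ q * cross (tr j)).
  rewrite im; apply: eq_bigr => j _.
  have -> : (-1) ^+ q = \prod_(l in initseg n m q) (-1) :> C.
    by rewrite prodr_const card_init.
  rewrite /cross -big_split; apply: eq_bigr => l _ /=.
  by rewrite trE mulN1r -mulrN -invrN opprB.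
have cross_out : dcoef C (initseg n m q :|: ps @: J)
   = (\prod_(j in ~: J) cross (tr j))
     * \prod_(i in J) \prod_(j in ~: J) `|(tr i + tr j) / (tr i - tr j)|.
  rewrite /dcoef brack_minus_select // big_select //=; congr (_ * _).
    rewrite exchange_big im; apply: eq_bigr => j _; rewrite /cross.
    apply: eq_bigr => l lq; rewrite trE addrC normf_div distrC.
    rewrite ger0_norm ?addr_ge0 ?ler0n // ger0_norm // subr_ge0 ler_nat.
    move: lq; rewrite inE => /andP[_ lq]; apply: (leq_trans lq).
    by have := slot_ord_gt leqn qp j; rewrite val_slot_ord // => /ltnW.
  apply: eq_bigr => i _; rewrite im.
  by apply: eq_bigr => j _; rewrite !trE.
pose c j := if (n < t j)%N then ((t j - n)./2)%N else 0%N.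
have cexpE : cexp (initseg n m q :|: ps @: J) = (\sum_(j in J) c j)%N.
  rewrite /cexp big_mkcondr big_select //= big1 ?add0n => [|i].
    by apply: eq_bigr => j _; rewrite val_slot_ord.
  by rewrite inE => /andP[_ iq]; rewrite ltnNge (leq_trans iq).
have wtE (A : {set 'I_p}) (x : C) : x ^+ wt (ps @: A) = \prod_(j in A) x ^+ t j.
  rewrite /wt expr_sum; rewrite (im (fun i => x ^+ i)).
  by apply: eq_bigr => j _; rewrite val_slot_ord.
have prodsetE (x : C) (A : {set 'I_p}) :
    prodset x (ps @: A) = \prod_(j in A) stepprod x (t j).
  rewrite /prodset (im (fun i => stepprod x i)).
  by apply: eq_bigr => j _; rewrite val_slot_ord.
rewrite cross_in cross_out cexpE !wtE !prodsetE -prodrXr.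
rewrite vdm_flip; last first.
  by move=> i j ltij; rewrite slot_inc // ltn_add2l.
have V0 : vdm tr p != 0.
  apply/prodf_neq0 => j _; apply/prodf_neq0 => i _.
  by rewrite (@slot_diff_neq0 _ n _ _) // ltn_add2l.
have allJ : \prod_(j < p) cross (tr j)
    = (\prod_(j in J) cross (tr j)) * \prod_(j in ~: J) cross (tr j).
  rewrite (bigID (mem J)) /=; congr (_ * _).
  by apply: eq_bigl => j; rewrite inE.
have signs : \prod_(j in J) ((-1) ^+ q * cross (tr j))
      * (\prod_(j in J) (-1) ^+ c j) * (\prod_(j in J) stepprod a (t j))
      * (\prod_(j in J) z ^+ t j)
    = (\prod_(j in J) cross (tr j)) * (\prod_(j in J) al j) * \prod_(j in J) (-1) ^+ j.
  rewrite -!big_split; apply: eq_bigr => j _ /=.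
  have sign_j : (-1) ^+ q * (-1) ^+ c j = - (-1) ^+ t j * (-1) ^+ j :> C.
    rewrite -exprD (_ : - (-1) ^+ t j * (-1) ^+ j = (-1) ^+ (t j + j).+1); last first.
      by rewrite exprS exprD mulN1r mulNr.
    rewrite -signr_odd -[RHS]signr_odd; congr (_ ^+ _).
    have ltj := ltn_ord j; rewrite /c /t /slot.
    by case: (ltnP (q + j) n) => ltqj; case: (ltnP n _) => ltn'; lia.
  rewrite /al (exprNn z).
  transitivity ((-1) ^+ q * (-1) ^+ c j * (cross (tr j) * stepprod a (t j) * z ^+ t j)).
    by ring.
  by rewrite sign_j; ring.
have split_be : \prod_(j in ~: J) be j
   = (\prod_(j in ~: J) stepprod b (t j)) * \prod_(j in ~: J) w ^+ t j.
  by rewrite -big_split.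
rewrite allJ split_be.
set P1 := \prod_(j in J) ((-1) ^+ q * cross (tr j)) in signs *.
set P2 := \prod_(j in J) (-1) ^+ c j in signs *.
set P3 := \prod_(j in J) stepprod a (t j) in signs *.
set P4 := \prod_(j in J) z ^+ t j in signs *.
set rho := \prod_(i in J) \prod_(j in ~: J) _.
set P5 := \prod_(j in ~: J) cross (tr j).
set P6 := \prod_(j in ~: J) stepprod b (t j).
set P7 := \prod_(j in ~: J) w ^+ t j.
transitivity (P1 * P2 * P3 * P4 * (P5 * rho * P6 * P7)); first by ring.
by rewrite signs; field.
Qed.

Lemma umemura_det : umemura n m q a b z w = (\prod_(j < p) cross (tr j))
  * (ndet p (fun i j => umemura_array n a b z w i (q + j)) / vdm tr p).
Proof.
rewrite umemura_slater; congr (_ * _).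
have -> : ndet p (fun i j => umemura_array n a b z w i (q + j))
   = ndet p (fun i j => be j * tr j ^+ i + al j * (- tr j) ^+ i).
  by apply: eq_ndet => i j _ _; rewrite /umemura_array twist_evalX /al mulNr.
rewrite (ndet_slater _ al be tr id) mulr_suml.
by apply: eq_bigr => J _; rewrite ndet_vdm.
Qed.

End UmemuraSlater.

Lemma cross0 (C : numFieldType) n m (x : C) : cross n m 0 x = 1.
Proof. by rewrite /cross big1 // => l; rewrite inE; case: (val l). Qed.

Lemma cross1 (C : numFieldType) n m (x : C) : (0 < n)%N ->
  cross n m 1 x = (x + 1) / (x - 1).
Proof.
move=> n0; have one : (1 < (n + 2 * m).+1)%N by lia.
rewrite /cross (_ : initseg n m 1 = [set Ordinal one]) ?big_set1 //.
by apply/setP => i; rewrite !inE -(inj_eq val_inj) /=; lia.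
Qed.

Section UmemuraDet.
Variables (C : numFieldType) (n m : nat) (a b z w : C).

Lemma umemura0_det N : N = (n + m)%N ->
  umemura n m 0 a b z w
  = ndet N (umemura_array n a b z w) / vdm (fun j => (slot n j)%:R) N.
Proof.
move=> NE; rewrite (umemura_det a b z w (leq0n n) NE).
by rewrite big1 ?mul1r // => j _; rewrite cross0.
Qed.

Lemma umemura1_det k : (0 < n)%N -> (n + m)%N = k.+1 ->
  umemura n m 1 a b z w
  = (\prod_(j < k) (((slot n j.+1)%:R + 1) / ((slot n j.+1)%:R - 1)))
    * ndet k (fun i j => umemura_array n a b z w i j.+1)
    / vdm (fun j => (slot n j.+1)%:R) k.
Proof.
move=> n0 Nk; rewrite (@umemura_det _ n m 1 k) //.
rewrite mulrA; congr (_ * _ / _).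
by apply: eq_bigr => j _; rewrite cross1.
Qed.

End UmemuraDet.

(** * Derivatives of monomials in sinh and cosh *)

Section Calculus.
Variable R : realType.

Lemma is_derive_sum_seq (I : Type) (s : seq I) (f : I -> R -> R) (dfs : I -> R)
    (x : R) :
  (forall i, is_derive x 1 (f i) (dfs i)) ->
  is_derive x 1 (fun t => \sum_(i <- s) f i t) (\sum_(i <- s) dfs i).
Proof.
move=> fdf; elim: s => [|i s IH].
  rewrite big_nil (_ : (fun t : R => _) = cst 0); first exact: is_derive_cst.
  by apply/funext => t; rewrite big_nil.
rewrite big_cons (_ : (fun t : R => _) = f i + (fun t => \sum_(i <- s) f i t)).
  exact: is_deriveD.
by apply/funext => t; rewrite big_cons.
Qed.

Lemma Re_mul_real (c : R[i]) (r : R) : complex.Re (c * r%:C%C) = complex.Re c * r.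
Proof. by case: c => u v /=; rewrite mulr0 subr0. Qed.

Lemma Im_mul_real (c : R[i]) (r : R) : complex.Im (c * r%:C%C) = complex.Im c * r.
Proof. by case: c => u v /=; rewrite mulr0 add0r. Qed.

Lemma cderive_sum (I : finType) (c : I -> R[i]) (r : I -> R -> R) (dr : I -> R)
    (x : R) :
  (forall i, is_derive x 1 (r i) (dr i)) ->
  cderive (fun t => \sum_i c i * (r i t)%:C%C) x = \sum_i c i * (dr i)%:C%C.
Proof.
move=> rdr; rewrite /cderive !derive1E.
have part (pr : {additive R[i] -> R}) :
    (forall c r, pr (c * r%:C%C) = pr c * r) ->
    'D_1 (fun t => pr (\sum_i c i * (r i t)%:C%C)) x
    = pr (\sum_i c i * (dr i)%:C%C).
  move=> prM; rewrite raddf_sum; under [RHS]eq_bigr do rewrite prM.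
  have -> : (fun t => pr (\sum_i c i * (r i t)%:C%C))
      = (fun t => \sum_i (pr (c i) *: r i) t).
    by apply/funext => t; rewrite raddf_sum; apply: eq_bigr => i _; rewrite prM.
  by have [_ ->] := @is_derive_sum_seq _ (index_enum I) (fun i => pr (c i) *: r i)
     (fun i => pr (c i) * dr i) x (fun i => is_deriveZ _ (rdr i)).
apply/eqP; rewrite eq_complex /=; apply/andP; split; apply/eqP.
  exact: (part (@complex.Re R) Re_mul_real).
exact: (part (@complex.Im R) Im_mul_real).
Qed.

Lemma near_cderive (f g : R -> R[i]) (x : R) :
  (\near x, f x = g x) -> cderive f x = cderive g x.
Proof.
move=> fg; rewrite /cderive !derive1E; congr (_ +i* _)%C; apply: near_eq_derive.
  by near do congr complex.Re.
by near do congr complex.Im.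
Unshelve. all: by end_near. Qed.

Definition half_sinh (t : R) : R := 2^-1 * (expR (t / 2) - expR (- (t / 2))).
Definition half_cosh (t : R) : R := 2^-1 * (expR (t / 2) + expR (- (t / 2))).

Lemma expR_half (t : R) : expR t = expR (t / 2) ^+ 2 :> R.
Proof. by rewrite expr2 -expRD; congr expR; lra. Qed.

Lemma wfun_cosh (t : R) : wfun t = half_cosh t.
Proof.
rewrite /wfun /half_cosh; congr (_ * _).
have -> : expR t + expR (- t) + 2 = (expR (t / 2) + expR (- (t / 2))) ^+ 2.
  rewrite (expR_half t) (expR_half (- t)) mulNr sqrrD.
  by rewrite -expRD subrr expR0; ring.
by rewrite sqrtr_sqr ger0_norm // addr_ge0 ?expR_ge0.
Qed.

Lemma zfun_sinh (t : R) : 0 < t -> zfun t = half_sinh t.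
Proof.
move=> t0; rewrite /zfun /half_sinh; congr (_ * _).
have -> : expR t + expR (- t) - 2 = (expR (t / 2) - expR (- (t / 2))) ^+ 2.
  rewrite (expR_half t) (expR_half (- t)) mulNr sqrrB.
  by rewrite -expRD subrr expR0; ring.
rewrite sqrtr_sqr ger0_norm // subr_ge0 ler_expR; lra.
Qed.

Lemma half_cosh2 (t : R) : half_cosh t ^+ 2 = half_sinh t ^+ 2 + 1.
Proof.
by rewrite /half_cosh /half_sinh !exprMn sqrrD sqrrB -expRD subrr expR0; field.
Qed.

Lemma is_derive_half (t : R) : is_derive t 1 (fun y : R => y / 2) 2^-1.
Proof.
rewrite (_ : (fun y : R => y / 2) = 2^-1 *: id).
  by apply: is_derive_eq; rewrite /GRing.scale /= mulr1.
by apply/funext => y; rewrite mulrC.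
Qed.

Lemma is_derive_sinh (t : R) : is_derive t 1 half_sinh (half_cosh t / 2).
Proof.
have h := is_derive_half t.
have e1 : is_derive t 1 (expR \o (fun y : R => y / 2)) (expR (t / 2) * 2^-1).
  exact: is_derive1_comp.
have e2 : is_derive t 1 (expR \o - (fun y : R => y / 2)) (expR (- (t / 2)) * - 2^-1).
  exact: is_derive1_comp.
have -> : half_sinh
  = 2^-1 *: ((expR \o (fun y : R => y / 2)) - (expR \o - (fun y : R => y / 2))).
  by apply/funext => y; reflexivity.
by apply: is_derive_eq; rewrite /half_cosh /GRing.scale /=; ring.
Qed.

Lemma is_derive_cosh (t : R) : is_derive t 1 half_cosh (half_sinh t / 2).
Proof.
have h := is_derive_half t.
have e1 : is_derive t 1 (expR \o (fun y : R => y / 2)) (expR (t / 2) * 2^-1).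
  exact: is_derive1_comp.
have e2 : is_derive t 1 (expR \o - (fun y : R => y / 2)) (expR (- (t / 2)) * - 2^-1).
  exact: is_derive1_comp.
have -> : half_cosh
  = 2^-1 *: ((expR \o (fun y : R => y / 2)) + (expR \o - (fun y : R => y / 2))).
  by apply/funext => y; reflexivity.
by apply: is_derive_eq; rewrite /half_sinh /GRing.scale /=; ring.
Qed.

Definition mono (k l : nat) (t : R) : R := half_sinh t ^+ k * half_cosh t ^+ l.
Definition dmono (k l : nat) (t : R) : R :=
  k%:R / 2 * mono k.-1 l.+1 t + l%:R / 2 * mono k.+1 l.-1 t.
Definition ddmono (k l : nat) (t : R) : R :=
  k%:R / 2 * dmono k.-1 l.+1 t + l%:R / 2 * dmono k.+1 l.-1 t.

Lemma is_derive_mono k l (t : R) : is_derive t 1 (mono k l) (dmono k l t).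
Proof.
have hs := is_derive_sinh t; have hc := is_derive_cosh t.
rewrite (_ : mono k l = half_sinh ^+ k * half_cosh ^+ l); last first.
  by apply/funext => y; rewrite /mono fctE !exprfctE.
apply: is_derive_eq; rewrite /dmono /mono /GRing.scale /= !exprfctE !exprS; ring.
Qed.

Lemma is_derive_dmono k l (t : R) : is_derive t 1 (dmono k l) (ddmono k l t).
Proof.
have d1 := is_deriveZ (k%:R / 2) (is_derive_mono k.-1 l.+1 t).
have d2 := is_deriveZ (l%:R / 2) (is_derive_mono k.+1 l.-1 t).
exact: (is_deriveD d1 d2).
Qed.

Lemma dmonoE k l (t : R) :
  2 * half_sinh t * half_cosh t * dmono k l t
  = (k%:R * half_cosh t ^+ 2 + l%:R * half_sinh t ^+ 2) * mono k l t.
Proof.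
by rewrite /dmono /mono; case: k => [|k]; case: l => [|l] /=; rewrite ?exprS; field.
Qed.

(** The predecessors in [dmono] and [ddmono] are multiplied by 0 when they are
    truncated. *)
Lemma ddmonoE k l (t : R) :
  4 * half_sinh t ^+ 2 * half_cosh t ^+ 2 * ddmono k l t
  = (k%:R * (k%:R - 1) * half_cosh t ^+ 4
     + (k%:R * (l%:R + 1) + l%:R * (k%:R + 1)) * (half_sinh t ^+ 2 * half_cosh t ^+ 2)
     + l%:R * (l%:R - 1) * half_sinh t ^+ 4) * mono k l t.
Proof.
rewrite /ddmono /dmono /mono.
by case: k => [|[|k]]; case: l => [|[|l]] /=; rewrite ?exprS -?natr1; field.
Qed.

End Calculus.

(** * The Hirota derivative of a sum of monomials *)

(** The hypotheses say that 2 z w d/dx multiplies each summand by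
    (sigma (z^2 + w^2) - e) / 2, and give the second derivative accordingly. *)
Lemma hirota_algebra (R : realType) (I : finType) (c : I -> R[i])
    (mo d1 d2 e : I -> R) (sx cx sigma : R) :
  cx ^+ 2 = sx ^+ 2 + 1 ->
  (forall i, 2 * sx * cx * d1 i
     = 2^-1 * (sigma * (sx ^+ 2 + cx ^+ 2) - e i) * mo i) ->
  (forall i, 4 * sx ^+ 2 * cx ^+ 2 * d2 i
     = (4^-1 * (sigma * (sx ^+ 2 + cx ^+ 2) - e i) ^+ 2
        - 2^-1 * (sx ^+ 2 + cx ^+ 2) * (sigma * (sx ^+ 2 + cx ^+ 2) - e i)
        + 2 * sigma * sx ^+ 2 * cx ^+ 2) * mo i) ->
  let z := sx%:C%C in let w := cx%:C%C in let s := z ^+ 2 + w ^+ 2 in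
  let F0 := \sum_i c i * (mo i)%:C%C in
  let F1 := \sum_i c i * (d1 i)%:C%C in
  let F2 := \sum_i c i * (d2 i)%:C%C in
  let Y := \sum_i (e i)%:C%C * (c i * (mo i)%:C%C) in
  let Z := \sum_i (e i)%:C%C ^+ 2 * (c i * (mo i)%:C%C) in
  8 * z ^+ 2 * w ^+ 2 * (F2 * F0 - 2 * (F1 * F1) + F0 * F2)
  = F0 * Z - Y ^+ 2 + 2 * s * F0 * Y - 2 * sigma%:C%C * F0 ^+ 2.
Proof.
move=> cs first_term second_term z w s X F1 F2 Y Z.
have E1 : 2 * z * w * F1 = 2^-1 * (sigma%:C%C * s * X - Y).
  rewrite /F1 /X /Y !mulr_sumr -sumrB mulr_sumr; apply: eq_bigr => i _.
  transitivity (c i * (2 * sx * cx * d1 i)%:C%C).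
    by rewrite !rmorphM rmorph_nat /z /w; ring.
  rewrite first_term !(rmorphM, rmorphB, rmorphD, rmorphXn, fmorphV, rmorph_nat).
  by rewrite /s /z /w; ring.
have E2 : 4 * z ^+ 2 * w ^+ 2 * F2
    = 4^-1 * (sigma%:C%C ^+ 2 * s ^+ 2 * X - 2 * sigma%:C%C * s * Y + Z)
      - 2^-1 * s * (sigma%:C%C * s * X - Y) + 2 * sigma%:C%C * z ^+ 2 * w ^+ 2 * X.
  transitivity (\sum_i (4^-1 * (sigma%:C%C * s - (e i)%:C%C) ^+ 2
        - 2^-1 * s * (sigma%:C%C * s - (e i)%:C%C)
        + 2 * sigma%:C%C * z ^+ 2 * w ^+ 2) * (c i * (mo i)%:C%C)).
    rewrite /F2 mulr_sumr; apply: eq_bigr => i _.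
    transitivity (c i * (4 * sx ^+ 2 * cx ^+ 2 * d2 i)%:C%C).
      by rewrite !(rmorphM, rmorphXn, rmorph_nat) /z /w; ring.
    rewrite second_term !(rmorphM, rmorphB, rmorphD, rmorphXn, fmorphV, rmorph_nat).
    by rewrite /s /z /w; ring.
  transitivity (\sum_i ((4^-1 * sigma%:C%C ^+ 2 * s ^+ 2 - 2^-1 * sigma%:C%C * s ^+ 2
         + 2 * sigma%:C%C * z ^+ 2 * w ^+ 2) * (c i * (mo i)%:C%C)
       + (2^-1 * s - 4^-1 * 2 * sigma%:C%C * s) * ((e i)%:C%C * (c i * (mo i)%:C%C))
       + 4^-1 * ((e i)%:C%C ^+ 2 * (c i * (mo i)%:C%C)))).
    by apply: eq_bigr => i _; ring.
  by rewrite !big_split /= -!mulr_sumr -/X -/Y -/Z; ring.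
have s2 : s ^+ 2 = 1 + 4 * z ^+ 2 * w ^+ 2.
  have wz : w ^+ 2 = z ^+ 2 + 1 by rewrite /w /z -!rmorphXn cs rmorphD rmorph1.
  by rewrite /s wz; ring.
transitivity (4 * X * (4 * z ^+ 2 * w ^+ 2 * F2) - 4 * (2 * z * w * F1) ^+ 2); first by ring.
rewrite E1 E2.
transitivity (X * Z - Y ^+ 2 + 2 * s * X * Y
  - 2 * sigma%:C%C * X ^+ 2 * (s ^+ 2 - 4 * z ^+ 2 * w ^+ 2)); first by field.
by rewrite s2; ring.
Qed.

Section HirotaSum.
Variables (R : realType) (I : finType) (c : I -> R[i]) (k l : I -> nat) (sigma : nat).
Variables (F : R -> R[i]) (x : R).
Hypothesis x0 : 0 < x.
Hypothesis kl : forall i, (k i + l i = sigma)%N.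
Hypothesis FE : forall t, F t = \sum_i c i * (zfun t ^+ k i * wfun t ^+ l i)%:C%C.

Lemma cderive_monomials t : 0 < t ->
  cderive F t = \sum_i c i * (dmono (k i) (l i) t)%:C%C.
Proof.
move=> t0.
rewrite (@near_cderive _ F (fun t => \sum_i c i * (mono (k i) (l i) t)%:C%C)).
  by apply: cderive_sum => i; apply: is_derive_mono.
near=> y; rewrite FE; apply: eq_bigr => i _; rewrite /mono wfun_cosh zfun_sinh //.
near: y; exact: lt_nbhsr.
Unshelve. all: by end_near. Qed.

Lemma cderive2_monomials t : 0 < t ->
  cderive (cderive F) t = \sum_i c i * (ddmono (k i) (l i) t)%:C%C.
Proof.
move=> t0.
rewrite (@near_cderive _ (cderive F) (fun t => \sum_i c i * (dmono (k i) (l i) t)%:C%C)).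
  by apply: cderive_sum => i; apply: is_derive_dmono.
near=> y; rewrite cderive_monomials //.
near: y; exact: lt_nbhsr.
Unshelve. all: by end_near. Qed.

Let z : R[i] := (zfun x)%:C%C.
Let w : R[i] := (wfun x)%:C%C.
Let e i : R[i] := (l i)%:R - (k i)%:R.
Let u i : R[i] := c i * (zfun x ^+ k i * wfun x ^+ l i)%:C%C.

Lemma hirota_sum :
  8 * z ^+ 2 * w ^+ 2 * hirota2 F F x
  = (\sum_i u i) * (\sum_i e i ^+ 2 * u i) - (\sum_i e i * u i) ^+ 2
    + 2 * (z ^+ 2 + w ^+ 2) * (\sum_i u i) * (\sum_i e i * u i)
    - 2 * sigma%:R * (\sum_i u i) ^+ 2.
Proof.
pose er i : R := (l i)%:R - (k i)%:R.
have kE i : (k i)%:R = (sigma%:R - er i) / 2 by rewrite -(kl i) natrD /er; field.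
have lE i : (l i)%:R = (sigma%:R + er i) / 2 by rewrite -(kl i) natrD /er; field.
have uE i : c i * (mono (k i) (l i) x)%:C%C = u i.
  by rewrite /u /mono wfun_cosh zfun_sinh.
have eE i : (er i)%:C%C = e i by rewrite /er rmorphB !rmorph_nat.
have main := @hirota_algebra R I c (fun i => mono (k i) (l i) x)
  (fun i => dmono (k i) (l i) x) (fun i => ddmono (k i) (l i) x) er
  (half_sinh x) (half_cosh x) sigma%:R (half_cosh2 x).
rewrite /hirota2 cderive2_monomials // cderive_monomials // FE -/u.
have sum0 : \sum_i c i * (mono (k i) (l i) x)%:C%C = \sum_i u i.
  by apply: eq_bigr => i _; rewrite uE.
have sum1 : \sum_i (er i)%:C%C * (c i * (mono (k i) (l i) x)%:C%C) = \sum_i e i * u i.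
  by apply: eq_bigr => i _; rewrite uE eE.
have sum2 : \sum_i (er i)%:C%C ^+ 2 * (c i * (mono (k i) (l i) x)%:C%C)
    = \sum_i e i ^+ 2 * u i.
  by apply: eq_bigr => i _; rewrite uE eE.
move: main; rewrite /= sum0 sum1 sum2 -zfun_sinh // -wfun_cosh rmorph_nat.
apply=> i; first by rewrite zfun_sinh // wfun_cosh dmonoE kE lE half_cosh2; field.
rewrite zfun_sinh // wfun_cosh ddmonoE kE lE.
have -> : half_cosh x ^+ 4 = (half_cosh x ^+ 2) ^+ 2 by rewrite -exprM.
by rewrite half_cosh2; field.
Qed.

End HirotaSum.

(** * The Hirota derivative of Umemura polynomials *)

Section UmemuraHirota.
Variables (R : realType) (n m k : nat) (a b : R[i]) (x : R).
Hypothesis Nk : (n + m)%N = k.+1.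
Hypothesis x0 : 0 < x.

Let t j := slot n j.
Let tr j : R[i] := (t j)%:R.
Let z : R[i] := (zfun x)%:C%C.
Let w : R[i] := (wfun x)%:C%C.
Let V := vdm tr k.+1.
Let G := umemura_array n a b z w.

Let weight (J : {set 'I_k.+1}) : nat := (\sum_(j in J) t j)%N.
Let coef (J : {set 'I_k.+1}) : R[i] :=
  (\prod_(j in J) - (stepprod a (t j) * (-1) ^+ t j))
  * (\prod_(j in ~: J) stepprod b (t j)) * vdm (flip J tr) k.+1 / V.

Lemma weight_split (J : {set 'I_k.+1}) :
  (weight J + weight (~: J) = \sum_(j < k.+1) t j)%N.
Proof.
rewrite /weight [RHS](bigID (mem J)) /=; congr (_ + _)%N.
by apply: eq_bigl => j; rewrite inE.
Qed.

Lemma weight_flip (J : {set 'I_k.+1}) :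
  (weight (~: J))%:R - (weight J)%:R = \sum_(j < k.+1) flip J tr j :> R[i].
Proof.
rewrite /weight !natr_sum [RHS](bigID (mem J)) /= addrC -sumrN; congr (_ + _).
  by apply: eq_big => j; rewrite inE // flip_ord => /negPf ->.
by apply: eq_bigr => j jJ; rewrite flip_ord jJ.
Qed.

Lemma monomial_coef (zz ww : R) (J : {set 'I_k.+1}) :
  (\prod_(j in J) - (stepprod a (t j) * (- zz%:C%C) ^+ t j))
  * (\prod_(j in ~: J) (stepprod b (t j) * ww%:C%C ^+ t j))
  * vdm (flip J tr) k.+1 / V
  = coef J * (zz ^+ weight J * ww ^+ weight (~: J))%:C%C.
Proof.
rewrite rmorphM !rmorphXn /weight !expr_sum big_split /=.
have -> : \prod_(j in J) - (stepprod a (t j) * (- zz%:C%C) ^+ t j)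
  = (\prod_(j in J) - (stepprod a (t j) * (-1) ^+ t j)) * \prod_(j in J) zz%:C%C ^+ t j.
  by rewrite -big_split; apply: eq_bigr => j _ /=; rewrite (exprNn zz%:C%C); ring.
by rewrite /coef; ring.
Qed.

Lemma umemura_fun_monomials y : umemura_fun n m 0 a b y
  = \sum_J coef J * (zfun y ^+ weight J * wfun y ^+ weight (~: J))%:C%C.
Proof.
rewrite /umemura_fun (umemura_slater _ _ _ _ (leq0n n) (esym Nk)).
rewrite big1 ?mul1r => [|j _]; last exact: cross0.
by apply: eq_bigr => J _; rewrite -monomial_coef.
Qed.

Lemma hirota_umemura :
  8 * z ^+ 2 * w ^+ 2 * hirota2 (umemura_fun n m 0 a b) (umemura_fun n m 0 a b) x
  = rdet0 k G / V * ((rdet11 k G + rdet2 k G) / V) - (rdet1 k G / V) ^+ 2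
    + 2 * (z ^+ 2 + w ^+ 2) * (rdet0 k G / V) * (rdet1 k G / V)
    - 2 * (\sum_(j < k.+1) tr j) * (rdet0 k G / V) ^+ 2.
Proof.
rewrite (hirota_sum x0 weight_split umemura_fun_monomials).
pose al j := - (stepprod a (t j) * (- z) ^+ t j).
pose be j := stepprod b (t j) * w ^+ t j.
have GE : G = fun i j => be j * tr j ^+ i + al j * (- tr j) ^+ i.
  apply/funext => i; apply/funext => j.
  by rewrite /G /umemura_array twist_evalX /al mulNr.
have uE J : coef J * (zfun x ^+ weight J * wfun x ^+ weight (~: J))%:C%C
   = (\prod_(j in J) al j) * (\prod_(j in ~: J) be j) * vdm (flip J tr) k.+1 / V.
  by rewrite -monomial_coef.
rewrite GE (slater_rdet0 k al be tr) (slater_rdet1 k al be tr) (slater_rdet2 k al be tr).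
rewrite natr_sum; congr (_ * _ - _ ^+ 2 + 2 * _ * _ * _ - _ * _ ^+ 2);
  by rewrite mulr_suml; apply: eq_bigr => J _; rewrite uE ?weight_flip ?mulrA.
Qed.

End UmemuraHirota.

Theorem theorem1 (R : realType) (n m : nat) (a b : R[i]) (x : R)
  (hm : (1 <= m)%N) (hx : 0 < x) :
  let z := (zfun x)%:C%C in
  let w := (wfun x)%:C%C in
  let U := fun l : nat => umemura_fun n l 0 a b in
  let U1 := fun l : nat => umemura_fun n l 1 a b in
  U m.-1 x * U m.+1 x
  = (- bar a (n + 2 * m + 2) * z ^+ 2 + bar b (n + 2 * m + 2) * w ^+ 2)
      * U m x ^+ 2
    + 8 * z ^+ 2 * w ^+ 2 * hirota2 (U m) (U m) x
    - 4 / (n + 2 * m + 1)%:R ^+ 2 * a * b * (a - b) * z ^+ 2 * w ^+ 2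
      * U1 m x ^+ 2.
Proof.
move=> z w U U1.
have wz : w ^+ 2 = z ^+ 2 + 1.
  by rewrite /w /z -!rmorphXn wfun_cosh zfun_sinh // half_cosh2 rmorphD rmorph1.
have [k Nk] : exists k, (n + m)%N = k.+1 by exists (n + m).-1; lia.
have := @toda_determinants _ n m k a b z w wz hm Nk.
rewrite /U (hirota_umemura a b Nk hx) // -/z -/w => main.
rewrite /umemura_fun -/z -/w.
rewrite (@umemura0_det _ n m.-1 _ _ _ _ k); last by lia.
rewrite (@umemura0_det _ n m.+1 _ _ _ _ k.+2); last by lia.
rewrite (@umemura0_det _ n m _ _ _ _ k.+1) // main; congr (_ - _).
rewrite /U1 /umemura_fun -/z -/w.
case: (posnP n) => [->|n0].
  by rewrite /umemura /= expr0n /= !mulr0 mul0r.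
by rewrite mul1r (@umemura1_det _ n m _ _ _ _ k).
Qed.
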